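(* There is a universal constant $c_{\mathrm{uni},1}>0$ such that the following holds for the model-based FedLQR iteration described in the context. Suppose the heterogeneity level satisfies $(\epsilon_1\bar h^1_{\mathrm{het}}+\epsilon_2\bar h^2_{\mathrm{het}})^2\le \bar h^3_{\mathrm{het}}$. Then there exist constant step-sizes $\eta_g>0$ and $\eta_l>0$ such that, with $\eta:=L\eta_g\eta_l$, for every number of rounds $N$ and every $i\in[M]$, $$C^{(i)}(K_N)-C^{(i)}(K_i^* )\le\left(1-\frac{\eta\mu^2\sigma_{\min}(R)}{\|\Sigma_{K_i^*}\|}\right)^N\left(C^{(i)}(K_0)-C^{(i)}(K_i^* )\right)+c_{\mathrm{uni},1}\,\mathcal B(\epsilon_1,\epsilon_2),$$ where $\mathcal B(\epsilon_1,\epsilon_2):=\frac{\upsilon\|\Sigma_{K_i^*}\|}{4\mu^2\sigma_{\min}(R)}(\epsilon_1\bar h^1_{\mathrm{het}}+\epsilon_2\bar h^2_{\mathrm{het}})^2$ and $\upsilon:=\min\{n_x,n_u\}$. Moreover, $K_n\in\mathcal G^0$ for all $n=0,\dots,N$.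
   Context: Setting. There are $M\ge1$ agents, $[M]=\{1,\dots,M\}$. Agent $i$ has the system $x^{(i)}_{t+1}=A^{(i)}x^{(i)}_t+B^{(i)}u^{(i)}_t$, $A^{(i)}\in\mathbb R^{n_x\times n_x}$, $B^{(i)}\in\mathbb R^{n_x\times n_u}$, $(A^{(i)},B^{(i)})$ stabilizable, $x_0^{(i)}\sim\mathcal D$ (same $\mathcal D$ for all agents). $\mathcal D$ has mean zero, $\Sigma_0:=\mathbb E[x_0x_0^\top]$ satisfies $\mu:=\sigma_{\min}(\Sigma_0)>0$, and $\|x_0\|\le H$ almost surely. $Q\in\mathbb R^{n_x\times n_x}$, $R\in\mathbb R^{n_u\times n_u}$ are positive definite. For $K\in\mathbb R^{n_u\times n_x}$, $C^{(i)}(K):=\mathbb E\left[\sum_{t=0}^\infty x_t^{(i)\top}Qx^{(i)}_t+u_t^{(i)\top}Ru_t^{(i)}\right]$ under $u^{(i)}_t=-Kx^{(i)}_t$ ($+\infty$ if divergent), $K_i^*$ is a minimizer of $C^{(i)}$, and $\Sigma^{(i)}_K:=\mathbb E\sum_{t=0}^\infty x^{(i)}_tx^{(i)\top}_t$ under $u_t^{(i)}=-Kx_t^{(i)}$; $\Sigma_{K_i^*}$ means $\Sigma^{(i)}_{K_i^*}$. $K$ stabilizes system $i$ if the spectral radius $\rho(A^{(i)}-B^{(i)}K)<1$. Matrix norms $\|\cdot\|$ are spectral; $\|S\|_{\max}:=\max_i\|S^{(i)}\|$ for a family of matrices; $C_{\max}(K):=\max_iC^{(i)}(K)$. Heterogeneity: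 $\epsilon_1,\epsilon_2>0$ are constants with $\max_{i,j}\|A^{(i)}-A^{(j)}\|\le\epsilon_1$ and $\max_{i,j}\|B^{(i)}-B^{(j)}\|\le\epsilon_2$. Initial controller: $K_0$ is given and stabilizes all $M$ systems. Stabilizing set: for a fixed finite constant $\beta\ge1$, $\mathcal G^0:=\bigcap_{i=1}^M\{K:\ C^{(i)}(K)-C^{(i)}(K_i^* )\le\beta(C^{(i)}(K_0)-C^{(i)}(K_i^* ))\}$. Heterogeneity functions: $h^1_{\mathrm{het}},h^2_{\mathrm{het}}$ are fixed positive functions of $K$, depending only on the parameters of the LQR problem ($\|A\|_{\max},\|B\|_{\max},\|A-BK\|_{\max},\|K\|,\|Q\|,\|R\|,\|\Sigma_0\|,\mu,\sigma_{\min}(Q),C_{\max}(K)$), bounded on $\mathcal G^0$, for which $\|\nabla C^{(i)}(K)-\nabla C^{(j)}(K)\|\le\epsilon_1h^1_{\mathrm{het}}(K)+\epsilon_2h^2_{\mathrm{het}}(K)$ for all $i,j\in[M]$ and all $K$ stabilizing every system. Put $\bar h^1_{\mathrm{het}}:=\sup_{K\in\mathcal G^0}h^1_{\mathrm{het}}(K)$, $\bar h^2_{\mathrm{het}}:=\sup_{K\in\mathcal G^0}h^2_{\mathrm{het}}(K)$, and $$\bar h^3_{\mathrm{het}}:=\min_{j\in[M]}\frac{\mu^2\sigma_{\min}(R)\,(C^{(j)}(K_0)-C^{(j)}(K_j^* ))}{4\|\Sigma_{K_j^*}\|\min\{n_x,n_u\}}.$$ Model-based FedLQR (exact gradients): with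 $L\ge1$ local steps per round and local/global step-sizes $\eta_l,\eta_g$, in round $n=0,1,\dots$ each agent sets $K^{(i)}_{n,0}=K_n$ and $K^{(i)}_{n,l+1}=K^{(i)}_{n,l}-\eta_l\nabla C^{(i)}(K^{(i)}_{n,l})$ for $l=0,\dots,L-1$; then $K_{n+1}=K_n+\frac{\eta_g}{M}\sum_{i=1}^M(K^{(i)}_{n,L}-K_n)$, i.e. $K_{n+1}=K_n-\frac{\eta}{ML}\sum_{i=1}^M\sum_{l=0}^{L-1}\nabla C^{(i)}(K^{(i)}_{n,l})$. *)

(* Defs.v *)
From HB Require Import structures.
From mathcomp Require Import all_boot all_order all_algebra.
From mathcomp Require Import all_classical all_reals all_analysis.
From mathcomp Require Import complex.

Set Implicit Arguments.
Unset Strict Implicit.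
Unset Printing Implicit Defensive.

Import Order.TTheory GRing.Theory Num.Theory.
Import numFieldNormedType.Exports.

Local Open Scope classical_set_scope.
Local Open Scope ring_scope.

Definition l2norm (R : realType) n (v : 'cV[R]_n) : R :=
  Num.sqrt (\sum_(a < n) v a 0 ^+ 2).

Definition quad (R : realType) n (W : 'M[R]_n) (v : 'cV[R]_n) : R :=
  (v^T *m W *m v) 0 0.

Definition posdef (R : realType) n (W : 'M[R]_n) : Prop :=
  W^T = W /\ forall v : 'cV[R]_n, v != 0 -> 0 < quad W v.

(* For m < n this also contains the n - m trivial zeros of W^T W; they affect
   neither the largest singular value nor [sigma_min], which is only used on
   square matrices. *)
Definition singular_values (R : realType) m n (W : 'M[R]_(m, n)) : set R :=
  [set Num.sqrt a | a in [set a | eigenvalue (W^T *m W) a]].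

Definition specnorm (R : realType) m n (W : 'M[R]_(m, n)) : R :=
  sup (singular_values W).

Definition sigma_min (R : realType) n (W : 'M[R]_n) : R :=
  inf (singular_values W).

(* The eigenvalues are the complex ones. *)
Definition spectral_radius (R : realType) n (W : 'M[R]_n) : R :=
  sup [set ComplexField.Normc.normc z | z in
        [set z : R[i] | eigenvalue (map_mx (real_complex R) W) z]].

(* Gradient for the Frobenius inner product: the matrix of partial
   derivatives. *)
Definition gradient (R : realType) m n (f : 'M[R]_(m, n) -> R)
    (K : 'M[R]_(m, n)) : 'M[R]_(m, n) :=
  \matrix_(a < m, b < n) 'D_(delta_mx a b) f K.

(* [init] is the law D of the initial state, a Borel probability measure on
   R^nx, the latter being carried by the type of nx-tuples. *)
Record fedlqr (R : realType) (M nx nu : nat) := FedLQR {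
  sysA : 'I_M -> 'M[R]_nx ;
  sysB : 'I_M -> 'M[R]_(nx, nu) ;
  costQ : 'M[R]_nx ;
  costR : 'M[R]_nu ;
  init : probability (nx.-tuple R) R }.

Definition col_of_tuple (R : realType) n (x : n.-tuple R) : 'cV[R]_n :=
  \col_(a < n) tnth x a.

Definition closed_loop (R : realType) M nx nu (P : fedlqr R M nx nu)
    (i : 'I_M) (K : 'M[R]_(nu, nx)) : 'M[R]_nx :=
  sysA P i - sysB P i *m K.

Definition stabilizes (R : realType) M nx nu (P : fedlqr R M nx nu)
    (i : 'I_M) (K : 'M[R]_(nu, nx)) : Prop :=
  spectral_radius (closed_loop P i K) < 1.

Definition stabilizable (R : realType) M nx nu (P : fedlqr R M nx nu)
    (i : 'I_M) : Prop :=
  exists K : 'M[R]_(nu, nx), stabilizes P i K.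

Definition input (R : realType) nx nu (K : 'M[R]_(nu, nx)) (x : 'cV[R]_nx) :
  'cV[R]_nu := - K *m x.

Fixpoint state (R : realType) M nx nu (P : fedlqr R M nx nu) (i : 'I_M)
    (K : 'M[R]_(nu, nx)) (x0 : 'cV[R]_nx) (t : nat) : 'cV[R]_nx :=
  if t is t'.+1 then
    let x := state P i K x0 t' in sysA P i *m x + sysB P i *m input K x
  else x0.

Definition cost (R : realType) M nx nu (P : fedlqr R M nx nu) (i : 'I_M)
    (K : 'M[R]_(nu, nx)) : \bar R :=
  (\int[init P]_x0 \sum_(0 <= t <oo)
    let x := state P i K (col_of_tuple x0) t in
    (quad (costQ P) x + quad (costR P) (input K x))%:E)%E.

Definition is_minimizer (R : realType) M nx nu (P : fedlqr R M nx nu)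
    (i : 'I_M) (K : 'M[R]_(nu, nx)) : Prop :=
  forall K' : 'M[R]_(nu, nx), (cost P i K <= cost P i K')%E.

(* [fine] is harmless at a stabilizing K, near which the cost is finite. *)
Definition grad_cost (R : realType) M nx nu (P : fedlqr R M nx nu) (i : 'I_M)
    (K : 'M[R]_(nu, nx)) : 'M[R]_(nu, nx) :=
  gradient (fun K' => fine (cost P i K')) K.

Definition Sigma0 (R : realType) M nx nu (P : fedlqr R M nx nu) : 'M[R]_nx :=
  \matrix_(a < nx, b < nx)
    fine 'E_(init P)[fun x0 => tnth x0 a * tnth x0 b].

Definition mu (R : realType) M nx nu (P : fedlqr R M nx nu) : R :=
  sigma_min (Sigma0 P).

(* The series is entrywise, and converges absolutely when K stabilizes
   system i. *)
Definition SigmaK (R : realType) M nx nu (P : fedlqr R M nx nu) (i : 'I_M)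
    (K : 'M[R]_(nu, nx)) : 'M[R]_nx :=
  \matrix_(a < nx, b < nx)
    fine (\int[init P]_x0 \sum_(0 <= t <oo)
      let x := state P i K (col_of_tuple x0) t in (x a 0 * x b 0)%:E)%E.

Definition stab_set (R : realType) M nx nu (P : fedlqr R M nx nu)
    (Kstar : 'I_M -> 'M[R]_(nu, nx)) (K0 : 'M[R]_(nu, nx)) (beta : R) :
    set 'M[R]_(nu, nx) :=
  [set K | forall i, (cost P i K - cost P i (Kstar i)
                      <= beta%:E * (cost P i K0 - cost P i (Kstar i)))%E].

Record lqr_params (R : realType) := LQRParams {
  p_normA : R ; p_normB : R ; p_normABK : R ; p_normK : R ; p_normQ : R ;
  p_normR : R ; p_normSigma0 : R ; p_mu : R ; p_sminQ : R ; p_Cmax : \bar R }.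

Definition params (R : realType) M nx nu (P : fedlqr R M nx nu)
    (K : 'M[R]_(nu, nx)) : lqr_params R :=
  {| p_normA := \big[Num.max/0]_(i < M) specnorm (sysA P i) ;
     p_normB := \big[Num.max/0]_(i < M) specnorm (sysB P i) ;
     p_normABK := \big[Num.max/0]_(i < M) specnorm (closed_loop P i K) ;
     p_normK := specnorm K ;
     p_normQ := specnorm (costQ P) ;
     p_normR := specnorm (costR P) ;
     p_normSigma0 := specnorm (Sigma0 P) ;
     p_mu := mu P ;
     p_sminQ := sigma_min (costQ P) ;
     p_Cmax := \big[maxe/-oo%E]_(i < M) cost P i K |}.

Definition hbar (R : realType) M nx nu (P : fedlqr R M nx nu)
    (G : set 'M[R]_(nu, nx)) (h : lqr_params R -> R) : R :=
  sup [set h (params P K) | K in G].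

Definition hbar3 (R : realType) M nx nu (P : fedlqr R M nx nu)
    (Kstar : 'I_M -> 'M[R]_(nu, nx)) (K0 : 'M[R]_(nu, nx)) : R :=
  inf [set mu P ^+ 2 * sigma_min (costR P)
             * fine (cost P j K0 - cost P j (Kstar j))%E
           / (4 * specnorm (SigmaK P j (Kstar j)) * (minn nx nu)%:R)
      | j in [set: 'I_M]].

Fixpoint local_iter (R : realType) M nx nu (P : fedlqr R M nx nu) (eta_l : R)
    (i : 'I_M) (K : 'M[R]_(nu, nx)) (l : nat) : 'M[R]_(nu, nx) :=
  if l is l'.+1 then
    let K' := local_iter P eta_l i K l' in K' - eta_l *: grad_cost P i K'
  else K.

Fixpoint fed_iter (R : realType) M nx nu (P : fedlqr R M nx nu) (L : nat)
    (eta_g eta_l : R) (K0 : 'M[R]_(nu, nx)) (n : nat) : 'M[R]_(nu, nx) :=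
  if n is n'.+1 then
    let K := fed_iter P L eta_g eta_l K0 n' in
    K + (eta_g / M%:R) *: \sum_(i < M) (local_iter P eta_l i K L - K)
  else K0.

Definition het_bound (R : realType) M nx nu (P : fedlqr R M nx nu)
    (Kstar : 'I_M -> 'M[R]_(nu, nx)) (i : 'I_M) (e : R) : R :=
  (minn nx nu)%:R * specnorm (SigmaK P i (Kstar i))
    / (4 * mu P ^+ 2 * sigma_min (costR P)) * e ^+ 2.

(* Main.v *)
Require Import Defs.
From HB Require Import structures.
From mathcomp Require Import all_boot all_order all_algebra.
From mathcomp Require Import all_classical all_reals all_analysis.
From mathcomp Require Import measurable_realfun complex ring lra.

Set Implicit Arguments.
Unset Strict Implicit.
Unset Printing Implicit Defensive.

Import Order.TTheory GRing.Theory Num.Theory.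
Import numFieldNormedType.Exports.

Local Open Scope classical_set_scope.
Local Open Scope ring_scope.

(** Why the theorem holds.  Write F = A - B K for the closed loop of one agent.
    The gain K is stabilising exactly when the powers of F tend to 0, and then
    the cost is tr (V Sigma0), where V solves the Lyapunov equation
    V = Q + K^T R K + F^T V F, and the state covariance S solves the adjoint
    equation S = Sigma0 + F S F^T.  A finite cost conversely forces stability,
    because Q and Sigma0 are bounded below.

    Playing V for one gain against S for another gives an exact formula for the
    difference of two costs ([cost_fun_diff]).  It has two consequences.
    Completing the square in it yields gradient dominance
    ([gradient_dominance]): the suboptimality gap is at most
    |grad|^2 / (4 a), where a = mu^2 sigma_min(R) / |Sigma_{K^*}|.  Expanding it
    to first order, with the Lipschitz bounds that a comparison argument gives
    for V and S ([perturb_lyap]), shows that on a sublevel set of the cost all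
    second order quantities are controlled by one constant c
    ([smooth_bounds]): within distance 1/c the gain stays stabilising, the
    gradient is c-Lipschitz, and the cost is its linearisation up to
    c |D|^2.

    A round of the algorithm is one step of size eta along the average of all
    local gradients.  This direction differs from the gradient of agent i by
    the heterogeneity, at most omega = sqrt(min(nx, nu)) e in Frobenius norm with
    e = eps1 hbar1 + eps2 hbar2 ([dot_le_specnorm]), plus a drift due to the local steps, at most omega / 4 if the step is small
    since e > 0 ([fed_round]).  By the polarisation identity the cost then
    changes by at most - eta/2 |grad|^2 + eta omega^2, so with dominance
    gap' <= (1 - eta a) gap + eta omega^2.  The heterogeneity condition says
    that omega^2 / a is at most the initial gap, which makes the initial
    sublevel sets invariant, and unrolling the recurrence gives the rate and
    the residual omega^2 / a, that is, four times
    [het_bound]. *)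

(** * Frobenius inner product and positive semidefinite matrices *)

Section Frobenius.
Variable R : realType.
Implicit Types k : R.

(** The one inequality behind every Cauchy-Schwarz inequality below: a
    nonnegative binary quadratic form has a nonpositive discriminant. *)
Lemma discriminant_le (a b c : R) :
  (forall x y : R, 0 <= a * x ^+ 2 + b * (x * y) *+ 2 + c * y ^+ 2) ->
  b ^+ 2 <= a * c.
Proof.
move=> h; (* These five values suffice: together they give 0 <= (a + c) (a c - b^2). *)
have h1 := h c (- b); have h2 := h b (- a).
have h3 := h 1 (- b); have h4 := h 1 0; have h5 := h 0 1.
have a0 : 0 <= a by lra.
have c0 : 0 <= c by lra.
have [ac|ac] : a + c = 0 \/ 0 < a + c.
  by move: (addr_ge0 a0 c0); rewrite le_eqVlt => /orP[/eqP<-|]; [left|right].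
  have -> : a = 0 by lra.
  have -> : c = 0 by lra.
  move: h3; have -> : a = 0 by lra.
  have -> : c = 0 by lra.
  nra.
suff: 0 <= (a + c) * (a * c - b ^+ 2) by rewrite pmulr_rge0 // subr_ge0.
nra.
Qed.

Definition dot m n (A B : 'M[R]_(m, n)) : R := \tr (A^T *m B).

Definition fro m n (A : 'M[R]_(m, n)) : R := Num.sqrt (dot A A).

Lemma dotE m n (A B : 'M[R]_(m, n)) :
  dot A B = \sum_i \sum_j A i j * B i j.
Proof.
rewrite exchange_big; apply: eq_bigr => j _.
by rewrite mxE; apply: eq_bigr => i _; rewrite mxE.
Qed.

Lemma dotC m n (A B : 'M[R]_(m, n)) : dot A B = dot B A.
Proof. by rewrite /dot -mxtrace_tr trmx_mul trmxK. Qed.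

Lemma dotDr m n (A B C : 'M[R]_(m, n)) : dot A (B + C) = dot A B + dot A C.
Proof. by rewrite /dot mulmxDr mxtraceD. Qed.

Lemma dotZr m n k (A B : 'M[R]_(m, n)) : dot A (k *: B) = k * dot A B.
Proof. by rewrite /dot -scalemxAr mxtraceZ. Qed.

Lemma dotNr m n (A B : 'M[R]_(m, n)) : dot A (- B) = - dot A B.
Proof. by rewrite -scaleN1r dotZr mulN1r. Qed.

Lemma dotDl m n (A B C : 'M[R]_(m, n)) : dot (A + B) C = dot A C + dot B C.
Proof. by rewrite dotC dotDr !(dotC C). Qed.

Lemma dotZl m n k (A B : 'M[R]_(m, n)) : dot (k *: A) B = k * dot A B.
Proof. by rewrite dotC dotZr dotC. Qed.

Lemma dotNl m n (A B : 'M[R]_(m, n)) : dot (- A) B = - dot A B.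
Proof. by rewrite dotC dotNr dotC. Qed.

Lemma dot_ge0 m n (A : 'M[R]_(m, n)) : 0 <= dot A A.
Proof. by rewrite dotE; do 2!apply: sumr_ge0 => ? _; rewrite -expr2 sqr_ge0. Qed.

Lemma frosq m n (A : 'M[R]_(m, n)) : fro A ^+ 2 = dot A A.
Proof. by rewrite sqr_sqrtr // dot_ge0. Qed.

Lemma fro_ge0 m n (A : 'M[R]_(m, n)) : 0 <= fro A.
Proof. exact: sqrtr_ge0. Qed.

Lemma fro_le m n (A : 'M[R]_(m, n)) k : 0 <= k -> dot A A <= k ^+ 2 -> fro A <= k.
Proof. by move=> k0; rewrite -frosq ler_pXn2r ?nnegrE ?fro_ge0. Qed.

Lemma dot_sqr_le m n (A B : 'M[R]_(m, n)) : dot A B ^+ 2 <= dot A A * dot B B.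
Proof.
apply: discriminant_le => x y; apply: le_trans (dot_ge0 (x *: A + y *: B)) _.
rewrite !(dotDl, dotDr, dotZl, dotZr) (dotC B A); lra.
Qed.

Lemma dot_le m n (A B : 'M[R]_(m, n)) : `|dot A B| <= fro A * fro B.
Proof.
rewrite -(@ler_pXn2r _ 2) ?nnegrE ?mulr_ge0 ?fro_ge0 //.
by rewrite real_normK ?num_real // exprMn !frosq dot_sqr_le.
Qed.

Lemma froD m n (A B : 'M[R]_(m, n)) : fro (A + B) <= fro A + fro B.
Proof.
apply: fro_le; first by rewrite addr_ge0 ?fro_ge0.
rewrite !(dotDl, dotDr) (dotC B A) sqrrD !frosq.
have := le_trans (ler_norm _) (dot_le A B); lra.
Qed.

Lemma froZ m n k (A : 'M[R]_(m, n)) : fro (k *: A) = `|k| * fro A.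
Proof. by rewrite /fro dotZl dotZr mulrA -expr2 sqrtrM ?sqr_ge0// sqrtr_sqr. Qed.

Lemma froN m n (A : 'M[R]_(m, n)) : fro (- A) = fro A.
Proof. by rewrite -scaleN1r froZ normrN1 mul1r. Qed.

Lemma fro0 m n : fro (0 : 'M[R]_(m, n)) = 0.
Proof. by rewrite -(scale0r 0) froZ normr0 mul0r. Qed.

Lemma froB m n (A B : 'M[R]_(m, n)) : fro (A - B) <= fro A + fro B.
Proof. by rewrite -(froN B) froD. Qed.

Lemma fro_sum m n (I : Type) (r : seq I) (F : I -> 'M[R]_(m, n)) :
  fro (\sum_(i <- r) F i) <= \sum_(i <- r) fro (F i).
Proof.
elim/big_ind2: _ => [|A a B b hA hB|//]; first by rewrite fro0.
by apply: le_trans (froD _ _) _; rewrite lerD.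
Qed.

Lemma froT m n (A : 'M[R]_(m, n)) : fro A^T = fro A.
Proof. by rewrite /fro /dot trmxK mxtrace_mulC. Qed.

Lemma dot_rows m n (A : 'M[R]_(m, n)) : dot A A = \sum_i dot (row i A) (row i A).
Proof.
rewrite dotE; apply: eq_bigr => i _; rewrite dotE big_ord1.
by apply: eq_bigr => j _; rewrite !mxE.
Qed.

Lemma dot_cols m n (A : 'M[R]_(m, n)) : dot A A = \sum_j dot (col j A) (col j A).
Proof.
rewrite dotE exchange_big; apply: eq_bigr => j _; rewrite dotE.
by apply: eq_bigr => i _; rewrite big_ord1 !mxE.
Qed.

Lemma fro_mul m n p (A : 'M[R]_(m, n)) (B : 'M[R]_(n, p)) :
  fro (A *m B) <= fro A * fro B.
Proof.
apply: fro_le; first by rewrite mulr_ge0 ?fro_ge0.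
rewrite exprMn !frosq (dot_rows A) (dot_cols B) mulr_suml dotE.
apply: ler_sum => i _; rewrite mulr_sumr; apply: ler_sum => j _.
have -> : (A *m B) i j = dot (row i A)^T (col j B).
  by rewrite /dot trmxK mxE /mxtrace big_ord1 mxE; apply: eq_bigr => k _; rewrite !mxE.
rewrite -expr2; apply: le_trans (dot_sqr_le _ _) _.
by rewrite -!frosq froT.
Qed.

Lemma tr_mul_le m n (A : 'M[R]_(m, n)) (B : 'M[R]_(n, m)) :
  `|\tr (A *m B)| <= fro A * fro B.
Proof. by rewrite -{1}(trmxK A) -/(dot _ _) -(froT A) dot_le. Qed.

Lemma entry_sqr_le m n (A : 'M[R]_(m, n)) i j : A i j ^+ 2 <= dot A A.
Proof.
rewrite dotE (bigD1 i) //= (bigD1 j) //= -expr2 -addrA lerDl.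
rewrite addr_ge0 // ?sumr_ge0// => [k|k] _; first by rewrite -expr2 sqr_ge0.
by apply: sumr_ge0 => l _; rewrite -expr2 sqr_ge0.
Qed.

Lemma entry_le m n (A : 'M[R]_(m, n)) i j : `|A i j| <= fro A.
Proof.
rewrite -(@ler_pXn2r _ 2) ?nnegrE ?fro_ge0 //.
by rewrite real_normK ?num_real // frosq entry_sqr_le.
Qed.

Lemma fro_entries n (A : 'M[R]_n) k : (forall i j, `|A i j| <= k) -> fro A <= n%:R * k.
Proof.
case: n A => [A _|n A h]; first by rewrite /fro dotE big_ord0 sqrtr0 mul0r.
have k0 : 0 <= k by apply: le_trans (h 0 0).
apply: fro_le; first by rewrite mulr_ge0.
apply: (@le_trans _ _ (\sum_(i < n.+1) \sum_(j < n.+1) k ^+ 2)).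
  rewrite dotE; do 2!apply: ler_sum => ? _.
  by rewrite -expr2 -real_normK ?num_real // lerXn2r ?nnegrE.
by rewrite !sumr_const card_ord -mulrnA exprMn -[leLHS]mulr_natl natrM -expr2.
Qed.

Lemma fro_delta m n i j : fro (delta_mx i j : 'M[R]_(m, n)) = 1.
Proof.
rewrite /fro dotE (bigD1 i) //= (bigD1 j) //= mxE !eqxx mulr1 !big1 ?addr0 ?sqrtr1 //.
  by move=> k /negPf ki; rewrite big1 // => l _; rewrite mxE ki mul0r.
by move=> l /negPf lj; rewrite mxE lj andbF mul0r.
Qed.

Lemma dot_delta m n (A : 'M[R]_(m, n)) i j : dot A (delta_mx i j) = A i j.
Proof.
rewrite dotE (bigD1 i) //= (bigD1 j) //= mxE !eqxx mulr1 !big1 ?addr0 //.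
  by move=> k /negPf ki; rewrite big1 // => l _; rewrite mxE ki mulr0.
by move=> l /negPf lj; rewrite mxE lj andbF mulr0.
Qed.

Lemma quadE n (W : 'M[R]_n) v : quad W v = dot v (W *m v).
Proof. by rewrite /quad /dot mulmxA /mxtrace big_ord1. Qed.

Lemma quad_tr n (W : 'M[R]_n) v : quad W v = \tr (W *m (v *m v^T)).
Proof. by rewrite quadE /dot mxtrace_mulC mulmxA. Qed.

Lemma quadD n (W X : 'M[R]_n) v : quad (W + X) v = quad W v + quad X v.
Proof. by rewrite !quadE mulmxDl dotDr. Qed.

Lemma quadN n (W : 'M[R]_n) v : quad (- W) v = - quad W v.
Proof. by rewrite !quadE mulNmx dotNr. Qed.

Lemma quadB n (W X : 'M[R]_n) v : quad (W - X) v = quad W v - quad X v.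
Proof. by rewrite quadD quadN. Qed.

Lemma quadZ n k (W : 'M[R]_n) v : quad (k *: W) v = k * quad W v.
Proof. by rewrite !quadE -scalemxAl dotZr. Qed.

Lemma quad_scalar n k (v : 'cV[R]_n) : quad k%:M v = k * dot v v.
Proof. by rewrite quadE mul_scalar_mx dotZr. Qed.

Lemma quad_conj m n (G : 'M[R]_(m, n)) (W : 'M[R]_n) v :
  quad (G *m W *m G^T) v = quad W (G^T *m v).
Proof. by rewrite /quad trmx_mul trmxK !mulmxA. Qed.

Lemma quad_conjT m n (G : 'M[R]_(n, m)) (W : 'M[R]_n) v :
  quad (G^T *m W *m G) v = quad W (G *m v).
Proof. by rewrite -{2}(trmxK G) quad_conj trmxK. Qed.

Lemma quad_delta n (W : 'M[R]_n) a : quad W (delta_mx a 0) = W a a.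
Proof. by rewrite quadE dotC dot_delta -colE mxE. Qed.

Definition psd n (S : 'M[R]_n) := S^T = S /\ forall v, 0 <= quad S v.

Lemma posdef_psd n (S : 'M[R]_n) : posdef S -> psd S.
Proof.
case=> S_sym S_pos; split=> // v; have [->|/S_pos/ltW//] := eqVneq v 0.
by rewrite quadE mulmx0 /dot mulmx0 mxtrace0.
Qed.

Lemma psdD n (S T : 'M[R]_n) : psd S -> psd T -> psd (S + T).
Proof.
move=> [hS pS] [hT pT]; split; first by rewrite linearD /= hS hT.
by move=> v; rewrite quadD addr_ge0.
Qed.

Lemma psdZ n k (S : 'M[R]_n) : 0 <= k -> psd S -> psd (k *: S).
Proof.
move=> k0 [hS pS]; split; first by rewrite linearZ /= hS.
by move=> v; rewrite quadZ mulr_ge0.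
Qed.

Lemma psd_conj m n (G : 'M[R]_(m, n)) S : psd S -> psd (G *m S *m G^T).
Proof.
move=> [hS pS]; split; first by rewrite !trmx_mul trmxK hS mulmxA.
by move=> v; rewrite quad_conj.
Qed.

Lemma psd_conjT m n (G : 'M[R]_(n, m)) S : psd S -> psd (G^T *m S *m G).
Proof. by move=> hS; rewrite -{2}(trmxK G); apply: psd_conj. Qed.

Lemma psd_scalar n k : 0 <= k -> psd (k%:M : 'M[R]_n).
Proof.
move=> k0; split; first by rewrite tr_scalar_mx.
by move=> v; rewrite quad_scalar mulr_ge0 // dot_ge0.
Qed.

Lemma psd_gram m n (G : 'M[R]_(m, n)) : psd (G^T *m G).
Proof. by rewrite -[G^T]mulmx1; apply/psd_conjT/psd_scalar. Qed.

Lemma psd_ge n (m : R) (S : 'M[R]_n) (v : 'cV[R]_n) :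
  psd (S - m%:M) -> m * dot v v <= quad S v.
Proof. by case=> _ /(_ v); rewrite quadB quad_scalar subr_ge0. Qed.

Lemma psd_diag n (S : 'M[R]_n) a : psd S -> 0 <= S a a.
Proof. by case=> _ /(_ (delta_mx a 0)); rewrite quad_delta. Qed.

Lemma psd_tr_ge0 n (S : 'M[R]_n) : psd S -> 0 <= \tr S.
Proof. by move=> pS; apply: sumr_ge0 => a _; apply: psd_diag. Qed.

Lemma psd_cauchy n (S : 'M[R]_n) u v :
  psd S -> dot u (S *m v) ^+ 2 <= quad S u * quad S v.
Proof.
move=> [hS pS]; apply: discriminant_le => x y.
apply: le_trans (pS (x *: u + y *: v)) _.
have e : dot v (S *m u) = dot u (S *m v).
  by rewrite dotC /dot trmx_mul hS mulmxA.
rewrite !quadE mulmxDr -!scalemxAr !(dotDl, dotDr, dotZl, dotZr) e; lra.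
Qed.

Lemma psd_diag0 n (S : 'M[R]_n) a b : psd S -> S a a = 0 -> S a b = 0.
Proof.
move=> pS Sa0; have := psd_cauchy (delta_mx a 0) (delta_mx b 0) pS.
rewrite quad_delta Sa0 mul0r dotC dot_delta -colE mxE => h.
by apply/eqP; rewrite -sqrf_eq0 eq_le h sqr_ge0.
Qed.

(** The Cholesky step: subtracting the normalised square of a column with a
    positive diagonal entry keeps the matrix positive semidefinite, by
    Cauchy-Schwarz, and clears one more diagonal entry. *)
Lemma psd_sum_rank1 n (S : 'M[R]_n) :
  psd S -> exists s : seq 'cV[R]_n, S = \sum_(w <- s) w *m w^T.
Proof.
have [k] := ubnP #|[pred a | S a a != 0]|.
elim: k S => // k IH S; rewrite ltnS => hk pS.
have [/existsP[a Sa]|h] := boolP [exists a, S a a != 0]; last first.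
  exists [::]; rewrite big_nil; apply/matrixP => a b; rewrite mxE.
  apply: psd_diag0 => //; apply/eqP; move: h.
  by rewrite negb_exists => /forallP/(_ a); rewrite negbK.
have Sa0 : 0 < S a a by rewrite lt_def Sa psd_diag.
pose w := (Num.sqrt (S a a))^-1 *: col a S.
have wE b : (w *m w^T) b b = S b a ^+ 2 / S a a.
  rewrite mxE big_ord1 !mxE -expr2 exprMn exprVn sqr_sqrtr ?ltW //.
  by rewrite mulrC.
have quadw v : quad (w *m w^T) v = dot (delta_mx a 0) (S *m v) ^+ 2 / S a a.
  rewrite /quad mulmxA -mulmxA mxE big_ord1.
  have -> : (w^T *m v) 0 0 = (Num.sqrt (S a a))^-1 * dot (delta_mx a 0) (S *m v).
    rewrite [dot _ _]dotC dot_delta /w linearZ /= -scalemxAl mxE; congr (_ * _).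
    by rewrite tr_col pS.1 -row_mul mxE.
  have -> : (v^T *m w) 0 0 = (Num.sqrt (S a a))^-1 * dot (delta_mx a 0) (S *m v).
    rewrite [dot _ _]dotC dot_delta /w -scalemxAr mxE; congr (_ * _).
    by rewrite !mxE; apply: eq_bigr => j _; rewrite !mxE mulrC -{1}pS.1 mxE.
  by rewrite mulrACA -expr2 -expr2 exprVn sqr_sqrtr ?ltW // mulrC.
have pS' : psd (S - w *m w^T).
  split; first by rewrite linearB /= trmx_mul trmxK pS.1.
  move=> v; rewrite quadB quadw subr_ge0 ler_pdivrMr //.
  apply: le_trans (psd_cauchy _ _ pS) _.
  by rewrite quad_delta mulrC.
have S'E b : (S - w *m w^T) b b = S b b - S b a ^+ 2 / S a a.
  by rewrite -wE [LHS]mxE [X in _ + X]mxE.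
have [|s Es] := IH _ _ pS'.
  apply: leq_trans hk; apply: proper_card; apply/properP; split.
    apply/fintype.subsetP => b; rewrite !inE S'E.
    apply: contraNN => /eqP Sb.
    by rewrite Sb (psd_diag0 a pS Sb) expr0n mul0r subr0.
  exists a; rewrite !inE // S'E expr2 mulfK //.
  by rewrite subrr eqxx.
by exists (w :: s); rewrite big_cons -Es addrC subrK.
Qed.

(** The trace of A S is a sum of values of the form of A, one for each rank one
    term of S. *)
Lemma tr_psd_mul_ge0 n (A S : 'M[R]_n) : psd A -> psd S -> 0 <= \tr (A *m S).
Proof.
move=> [_ pA] /psd_sum_rank1[s ->]; rewrite mulmx_sumr raddf_sum /=.
by apply: sumr_ge0 => w _; rewrite -quad_tr.
Qed.

Lemma tr_psd_mul_ge n (m : R) (A S : 'M[R]_n) :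
  psd (A - m%:M) -> psd S -> m * \tr S <= \tr (A *m S).
Proof.
move=> pA pS; have := tr_psd_mul_ge0 pA pS.
by rewrite mulmxBl mul_scalar_mx linearB /= mxtraceZ subr_ge0.
Qed.

(** Polarisation at the basis vectors bounds each entry of X by tr S.  The
    dimensional factor this costs is harmless: the estimates built on it only
    assert that some constant exists. *)
Lemma psd_sandwich n (S X : 'M[R]_n) :
  psd (S - X) -> psd (S + X) -> fro X <= n%:R * \tr S.
Proof.
move=> pB pD; apply: fro_entries => a b.
have X_sym : X^T = X.
  have := pD.1; have := pB.1; rewrite linearB linearD /= => h1 h2.
  apply/matrixP => i j; have := congr1 (fun Z : 'M[R]_n => Z i j) h1.
  have := congr1 (fun Z : 'M[R]_n => Z i j) h2; rewrite !mxE; lra.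
have pS : psd S.
  have -> : S = 2^-1 *: ((S - X) + (S + X)).
    by apply/matrixP => i j; rewrite !mxE; lra.
  by apply: psdZ; [lra|apply: psdD].
have key x : (x = 1 \/ x = -1) -> x * X a b *+ 2 <= S a a + S b b.
  move=> hx; have := pD.2 (delta_mx a 0 - x *: delta_mx b 0).
  have := pB.2 (delta_mx a 0 + x *: delta_mx b 0).
  rewrite !quadB !quadD.
  have q (W : 'M[R]_n) y : quad W (delta_mx a 0 + y *: delta_mx b 0)
      = W a a + y * W a b + y * W b a + y ^+ 2 * W b b.
    rewrite !quadE mulmxDr -!scalemxAr !(dotDl, dotDr, dotZl, dotZr).
    rewrite -!colE -!(dotC (col _ _)) !dot_delta !mxE; lra.
  rewrite -scaleNr !q.
  have -> : X b a = X a b by rewrite -{1}X_sym mxE.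
  have -> : S b a = S a b by rewrite -{1}pS.1 mxE.
  case: hx => ->; lra.
have k1 := key 1 (or_introl erefl); have k2 := key (-1) (or_intror erefl).
have h c : S c c <= \tr S.
  rewrite /mxtrace (bigD1 c) //= lerDl; apply: sumr_ge0 => ? _; exact: psd_diag.
have := h a; have := h b; rewrite ler_norml => ? ?; apply/andP; split; lra.
Qed.

Lemma psd_fro n (S : 'M[R]_n) : psd S -> fro S <= n%:R * \tr S.
Proof.
move=> pS; apply: psd_sandwich; last exact: psdD.
by rewrite subrr -(scale0r S); apply: psdZ.
Qed.

Lemma fro_psd n (X : 'M[R]_n) k : X^T = X -> fro X <= k -> psd (k%:M - X).
Proof.
move=> hX hk; split; first by rewrite linearB /= tr_scalar_mx hX.
move=> v; rewrite quadB quad_scalar subr_ge0 quadE.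
apply: le_trans (ler_norm _) _; apply: le_trans (dot_le _ _) _.
rewrite -frosq expr2 mulrA (mulrC k) -mulrA ler_wpM2l ?fro_ge0 //.
by apply: le_trans (fro_mul _ _) _; rewrite ler_wpM2r ?fro_ge0.
Qed.

End Frobenius.

(** * Stability of a matrix: powers, spectral radius, Lyapunov equations *)

Definition stein (R : realType) n (F : 'M[R]_n) : 'M[R]_(n * n) :=
  1%:M - lin_mx (mulmxr F^T \o mulmx F).

(** The solution of the discrete Lyapunov (Stein) equation S = X + F S F^T.
    When the powers of F tend to 0 it is the sum of the series of the
    F^t X (F^t)^T, but linear algebra alone produces it, hence also the
    convergence of that series.  Only the equation matters, so it is locked. *)
HB.lock Definition lyap (R : realType) n (F X : 'M[R]_n) : 'M[R]_n :=
  vec_mx (mxvec X *m invmx (stein F)).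
Canonical lyap_unlockable := Unlockable lyap.unlock.
Arguments lyap {R n} F X.

Section Stability.
Variable R : realType.
Implicit Types k : R.

(** A sealed proposition: unification never looks into the limit. *)
Variant pow_cvg0 n (F : 'M[R]_n) : Prop :=
  PowCvg0 of fro (F ^+ t) @[t --> \oo] --> (0 : R).

Definition bounded_sums (u : nat -> R) : Prop :=
  exists c : R, forall T, \sum_(t < T) u t <= c.

Lemma bounded_sums_cvg0 (u : nat -> R) :
  (forall t, 0 <= u t) -> bounded_sums u -> u t @[t --> \oo] --> (0 : R).
Proof.
move=> u0 [c hc]; apply: (@cvg_series_cvg_0 R R^o u).
apply: nondecreasing_is_cvgn.
  by apply: (@nondecreasing_series R u predT 0) => t _ _.
exists c => _ [T _ <-]; rewrite /series /=.
by rewrite big_mkord.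
Qed.

Lemma squeeze0 (u v : nat -> R) (c : R) :
  (forall t, 0 <= u t <= c * v t) -> v t @[t --> \oo] --> (0 : R) ->
  u t @[t --> \oo] --> (0 : R).
Proof.
move=> h hv; apply: (@squeeze_cvgr _ _ _ _ (fun=> 0) (fun t => c * v t)).
- by near=> t; apply: h.
- exact: cvg_cst.
- by rewrite -(mulr0 c); apply: cvgMr.
Unshelve. all: by end_near. Qed.

Lemma le_cvg0 (u : nat -> R) (a : R) :
  (forall t, a <= u t) -> u t @[t --> \oo] --> (0 : R) -> a <= 0.
Proof.
move=> h hu; apply: (ler_cvg_to (cvg_cst a) hu); near=> t; exact: h.
Unshelve. all: by end_near. Qed.

Lemma trmx_exp n (F : 'M[R]_n) t : (F ^+ t)^T = F^T ^+ t.
Proof.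
elim: t => [|t IH]; first by rewrite !expr0 trmx1.
by rewrite exprS exprSr -!mulmxE trmx_mul IH.
Qed.

Lemma pow_cvg0_tr n (F : 'M[R]_n) : pow_cvg0 F -> pow_cvg0 F^T.
Proof.
move=> [h]; split; apply: (cvg_trans _ h); apply: near_eq_cvg.
by near=> t; rewrite -trmx_exp froT.
Unshelve. all: by end_near. Qed.

Lemma cvg0_conj n (F Z : 'M[R]_n) : pow_cvg0 F ->
  fro (F ^+ t *m Z *m (F ^+ t)^T) @[t --> \oo] --> (0 : R).
Proof.
move=> [h]; apply: (@squeeze0 _ (fun t => fro (F ^+ t) * fro (F ^+ t)) (fro Z)).
  move=> t; rewrite fro_ge0 /=; apply: le_trans (fro_mul _ _) _.
  rewrite froT mulrCA (mulrC (fro Z)) mulrA mulrAC ler_wpM2r ?fro_ge0//.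
  by rewrite mulrC mulrC fro_mul.
by rewrite -(mulr0 0); apply: cvgM.
Qed.

Lemma lyap_unroll n (F X S : 'M[R]_n) T :
  S = X + F *m S *m F^T ->
  S = \sum_(t < T) F ^+ t *m X *m (F ^+ t)^T + F ^+ T *m S *m (F ^+ T)^T.
Proof.
move=> hS; elim: T => [|T IH]; first by rewrite big_ord0 expr0 trmx1 add0r mul1mx mulmx1.
rewrite {1}IH big_ord_recr /= -addrA; congr (_ + _).
rewrite {1}hS mulmxDr mulmxDl; congr (_ + _).
by rewrite exprSr -!mulmxE trmx_mul !mulmxA.
Qed.

Lemma lyap_uniq0 n (F S : 'M[R]_n) : pow_cvg0 F -> S = F *m S *m F^T -> S = 0.
Proof.
move=> hF hS; apply/matrixP => i j; rewrite mxE.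
have eS t : S = F ^+ t *m S *m (F ^+ t)^T.
  rewrite {1}(@lyap_unroll _ F 0 S t) ?add0r // big1 ?add0r // => s _.
  by rewrite mulmx0 mul0mx.
apply/eqP; rewrite -normr_le0; apply: le_cvg0 (cvg0_conj S hF) => t.
by rewrite -eS entry_le.
Qed.

Lemma stein_unit n (F : 'M[R]_n) : pow_cvg0 F -> stein F \in unitmx.
Proof.
move=> hF; rewrite -row_free_unit -kermx_eq0; apply/rowV0P => v /sub_kermxP.
rewrite -[v]vec_mxK /stein mulmxBr mulmx1 mul_vec_lin /= -linearB /=.
move=> /(congr1 vec_mx); rewrite mxvecK linear0 => /eqP; rewrite subr_eq0 => /eqP h.
by rewrite (lyap_uniq0 hF h) linear0.
Qed.

Lemma lyapE n (F X : 'M[R]_n) : pow_cvg0 F -> lyap F X = X + F *m lyap F X *m F^T.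
Proof.
move=> hF; apply/eqP; rewrite -subr_eq; apply/eqP/(can_inj mxvecK).
transitivity (mxvec (lyap F X) *m stein F).
  by rewrite mulmxBr mulmx1 mul_vec_lin /= linearB.
by rewrite unlock vec_mxK mulmxKV // stein_unit.
Qed.

Lemma lyap_uniq n (F X S S' : 'M[R]_n) : pow_cvg0 F ->
  S = X + F *m S *m F^T -> S' = X + F *m S' *m F^T -> S = S'.
Proof.
move=> hF hS hS'; apply/eqP; rewrite -subr_eq0; apply/eqP/(lyap_uniq0 hF).
by rewrite {1}hS {1}hS' mulmxBr mulmxBl opprD addrACA subrr add0r.
Qed.

Lemma lyap_tr n (F X : 'M[R]_n) : pow_cvg0 F -> X^T = X -> (lyap F X)^T = lyap F X.
Proof.
move=> hF hX; apply: (lyap_uniq hF _ (lyapE X hF)).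
by rewrite {1}(lyapE X hF) linearD /= !trmx_mul trmxK hX mulmxA.
Qed.

(** S exceeds F^t S (F^t)^T by a sum of positive semidefinite terms, and the
    latter matrix tends to 0. *)
Lemma lyap_psd n (F X S : 'M[R]_n) : pow_cvg0 F ->
  S = X + F *m S *m F^T -> psd X -> psd S.
Proof.
move=> hF hS pX; have S_sym : S^T = S.
  apply: (lyap_uniq hF _ hS); rewrite {1}hS linearD /= !trmx_mul trmxK mulmxA.
  by rewrite pX.1.
split=> // v; rewrite -oppr_le0.
apply: (@le_cvg0 (fun t => fro (F ^+ t *m S *m (F ^+ t)^T) * dot v v)); last first.
  by rewrite -(mul0r (dot v v)); apply: cvgMl; exact: cvg0_conj.
move=> t; have h : psd (\sum_(s < t) F ^+ s *m X *m (F ^+ s)^T).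
  elim/big_ind: _ => [|*|s _]; [|exact: psdD|exact: psd_conj].
  by rewrite -(scale0r 1%:M); apply/psdZ/psd_scalar.
have h1 := h.2 v; have := congr1 (fun Z => quad Z v) (lyap_unroll t hS).
rewrite quadD; set W := F ^+ t *m S *m _ => e.
have pW : psd ((fro W)%:M - (- W)).
  apply: fro_psd; last by rewrite froN.
  by rewrite linearN /= !trmx_mul trmxK S_sym mulmxA.
have := pW.2 v; rewrite quadB quadN quad_scalar; lra.
Qed.

Lemma bounded_sums_pow_cvg0 n (F : 'M[R]_n) :
  bounded_sums (fun t => fro (F ^+ t) ^+ 2) -> pow_cvg0 F.
Proof.
move=> hb; split.
have -> : (fun t => fro (F ^+ t)) = (fun t => Num.sqrt (fro (F ^+ t) ^+ 2)).
  by apply/funext => t; rewrite sqrtr_sqr ger0_norm // fro_ge0.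
rewrite -(@sqrtr0 R); apply: continuous_cvg => //; first exact: sqrt_continuous.
by apply: bounded_sums_cvg0 => // t; exact: sqr_ge0.
Qed.

(** Lyapunov's criterion: S decreases along the iteration by at least
    c |F^t v|^2 and stays nonnegative, so the |F^t|^2 are summable. *)
Lemma lyapunov_pow_cvg0 n (F S : 'M[R]_n) (c : R) : 0 < c -> psd S ->
  psd (S - F *m S *m F^T - c%:M) -> pow_cvg0 F.
Proof.
move=> c0 pS; set X := S - _ => pX.
have hS : S = X + F *m S *m F^T by rewrite subrK.
apply: bounded_sums_pow_cvg0; exists (\tr S / c) => T.
rewrite ler_pdivlMr // mulr_suml.
rewrite (lyap_unroll T hS) linearD /= -[leLHS]addr0; apply: lerD; last first.
  exact/psd_tr_ge0/psd_conj.
rewrite linear_sum /=; apply: ler_sum => t _.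
have -> : \tr (F ^+ t *m X *m (F ^+ t)^T) = \tr (X *m ((F ^+ t)^T *m F ^+ t)).
  by rewrite -mulmxA mxtrace_mulC -mulmxA.
by rewrite frosq mulrC; apply: tr_psd_mul_ge pX (psd_gram _).
Qed.

End Stability.

(** * The spectral radius *)

Section Spectral.
Variable R : realType.

Local Notation C := R[i].
Local Notation normc := ComplexField.Normc.normc.

Let normcM (x y : C) : normc (x * y) = normc x * normc y.
Proof. exact: ComplexField.Normc.normcM. Qed.

Let normcD (x y : C) : normc (x + y) <= normc x + normc y.
Proof. exact: le_normcD. Qed.

Let normc_ge0 (x : C) : 0 <= normc x.
Proof. by case: x => a b; exact: sqrtr_ge0. Qed.

Let normcX (x : C) t : normc (x ^+ t) = normc x ^+ t.
Proof.
elim: t => [|t IH]; first by rewrite !expr0 ComplexField.Normc.normc1.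
by rewrite !exprS normcM IH.
Qed.

Let normc_real (x : R) : normc (real_complex R x) = `|x|.
Proof. by rewrite /= expr0n addr0 sqrtr_sqr. Qed.

Let normc_sum (I : Type) (r : seq I) (F : I -> C) :
  normc (\sum_(i <- r) F i) <= \sum_(i <- r) normc (F i).
Proof.
elim/big_ind2: _ => [|x a y b ha hb|//]; first by rewrite ComplexField.Normc.normc0.
by apply: le_trans (normcD _ _) _; rewrite lerD.
Qed.

Lemma bounded_sums_rec (x u : nat -> R) (r : R) : 0 <= r < 1 ->
  (forall t, 0 <= x t) ->
  (forall t, x t.+1 <= r * x t + u t) -> bounded_sums u -> bounded_sums x.
Proof.
move=> /andP[r0 r1] x0 hx [c hc]; exists ((x 0%N + c) / (1 - r)) => T.
rewrite ler_pdivlMr ?subr_gt0 //.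
have h : \sum_(t < T.+1) x t <= x 0%N + (r * \sum_(t < T) x t + c).
  rewrite big_ord_recl lerD2l mulr_sumr.
  apply: (@le_trans _ _ (\sum_(t < T) (r * x t + u t))).
    by apply: ler_sum => t _; exact: hx.
  by rewrite big_split /= lerD2l hc.
move: h; rewrite big_ord_recr /=; have := x0 T; lra.
Qed.

(** Multiplying by X - z turns the sequence w_t = q(F) F^t into
    w_{t+1} - z w_t, and a first order recurrence with |z| < 1 driven by a
    summable sequence has a summable solution. *)
Lemma bounded_sums_root n (F : 'M[C]_n.+1) (rs : seq C) (q : {poly C}) :
  {in rs, forall z, normc z < 1} ->
  let w (q : {poly C}) a b t := normc ((horner_mx F q *m F ^+ t) a b) in
  (forall a b, bounded_sums (w (\prod_(z <- rs) ('X - z%:P) * q) a b)) ->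
  forall a b, bounded_sums (w q a b).
Proof.
elim: rs q => [|z rs IH] q hz w; first by rewrite big_nil mul1r.
rewrite big_cons -mulrA mulrCA => h.
have hz' : {in rs, forall z, normc z < 1} by move=> y hy; apply: hz; rewrite inE hy orbT.
have {}h := IH _ hz' h.
move=> a b; apply: (@bounded_sums_rec _ _ (normc z) _ _ _ (h a b)) => [|t|t].
- by rewrite normc_ge0 hz // inE eqxx.
- exact: normc_ge0.
rewrite -normcM; apply: le_trans (normcD _ _); rewrite le_eqVlt; apply/orP; left.
apply/eqP; congr normc.
have -> : horner_mx F (('X - z%:P) * q) = horner_mx F q *m F - z *: horner_mx F q.
  rewrite mulrC rmorphM rmorphB /= horner_mx_X horner_mx_C mulrBr -!mulmxE.
  by rewrite mul_mx_scalar.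
by rewrite exprS -mulmxE mulmxBl -scalemxAl mulmxA !mxE addrCA subrr addr0.
Qed.

Lemma eigenvalue_roots n (W : 'M[C]_n) :
  exists rs : seq C, char_poly W = \prod_(z <- rs) ('X - z%:P) /\
    forall z, eigenvalue W z = (z \in rs).
Proof.
have [rs] := closed_field_poly_normal (char_poly W).
rewrite (monicP (char_poly_monic W)) scale1r => E; exists rs; split=> // z.
by rewrite eigenvalue_root_char E root_prod_XsubC.
Qed.

(** The eigenvalues are finitely many, so the supremum is a maximum whenever
    there are any. *)
Lemma spectral_radius_lt1 n (F : 'M[R]_n) :
  spectral_radius F < 1 <->
  forall z, eigenvalue (map_mx (real_complex R) F) z -> normc z < 1.
Proof.
rewrite /spectral_radius; set W := map_mx _ F.
have [rs [_ hrs]] := eigenvalue_roots W.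
pose m := \big[Num.max/0]_(z <- rs) normc z.
have hm z : eigenvalue W z -> normc z <= m.
  by rewrite hrs => hz; apply: le_bigmax_seq hz _.
set E := [set _ | _ in _]; split => h.
  move=> z hz; apply: le_lt_trans h.
  apply: sup_upper_bound; last by exists z.
  split; first by exists (normc z), z.
  by exists m => _ [y hy <-]; apply: hm.
have m1 : m < 1.
  rewrite /m big_seq_cond; elim/big_ind: _ => // [x y|z]; first by rewrite gt_max => -> ->.
  by rewrite andbT -hrs; exact: h.
have [->|/set0P E0] := eqVneq E set0; first by rewrite sup0.
apply: le_lt_trans m1; apply: ge_sup => // _ [y hy <-]; exact: hm.
Qed.

Lemma map_mx_pow n (F : 'M[R]_n) t :
  map_mx (real_complex R) (F ^+ t) = (map_mx (real_complex R) F) ^+ t.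
Proof.
elim: t => [|t IH]; first by rewrite !expr0 map_mx1.
by rewrite !exprS -!mulmxE map_mxM IH.
Qed.

Lemma fro_le_sum n (A : 'M[R]_n) : fro A <= \sum_a \sum_b `|A a b|.
Proof.
rewrite [A in fro A]matrix_sum_delta; apply: le_trans (fro_sum _ _) _.
apply: ler_sum => a _; apply: le_trans (fro_sum _ _) _.
by apply: ler_sum => b _; rewrite froZ fro_delta mulr1.
Qed.

(** If the powers tend to 0, a row eigenvector v with v F^t = z^t v excludes
    |z| >= 1.  Conversely, by Cayley-Hamilton the product of the F - z, z running
    over the eigenvalues, annihilates every F^t; peeling the factors off one
    at a time shows that the F^t are summable. *)
Theorem spectral_radius_pow_cvg0 n (F : 'M[R]_n) :
  spectral_radius F < 1 <-> pow_cvg0 F.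
Proof.
split=> [/spectral_radius_lt1 h|[hF]]; last first.
  apply/spectral_radius_lt1 => z /eigenvalueP[v hv v0].
  rewrite ltNge; apply/negP => z1.
  have [b vb] : exists b, v 0 b != 0.
    apply/existsP; apply: contraNT v0; rewrite negb_exists => /forallP h.
    by apply/eqP/rowP => b; rewrite mxE; apply/eqP; rewrite -[_ == _]negbK.
  have hvt t : v *m map_mx (real_complex R) (F ^+ t) = z ^+ t *: v.
    rewrite map_mx_pow; elim: t => [|t IH]; first by rewrite !expr0 mulmx1 scale1r.
    by rewrite !exprSr -mulmxE mulmxA IH -scalemxAl hv scalerA.
  suff : normc (v 0 b) <= 0.
    move=> h; move: vb; rewrite (@ComplexField.Normc.eq0_normc _ (v 0 b)) ?eqxx //.
    by apply/eqP; rewrite eq_le h normc_ge0.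
  pose k := \sum_a normc (v 0 a).
  apply: (@le_cvg0 _ (fun t => k * fro (F ^+ t))); last first.
    by rewrite -(mulr0 k); apply: cvgMr.
  move=> t; apply: (@le_trans _ _ (normc ((z ^+ t *: v) 0 b))).
    by rewrite mxE normcM normcX ler_peMl ?exprn_ege1.
  rewrite -hvt mxE; apply: le_trans (normc_sum _ _) _; rewrite mulr_suml.
  apply: ler_sum => a _; rewrite normcM mxE normc_real.
  by rewrite ler_wpM2l ?entry_le.
case: n F h => [F _|n F h].
  split; rewrite [X in X @ _](_ : _ = fun=> 0); first exact: cvg_cst.
  by apply/funext => t; rewrite /fro dotE big_ord0 sqrtr0.
set W := map_mx _ F in h.
have [rs [Ers hrs]] := eigenvalue_roots W.
have hz : {in rs, forall z, normc z < 1} by move=> z; rewrite -hrs; apply: h.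
have hb a b : bounded_sums (fun t => `|(F ^+ t) a b|).
  have := @bounded_sums_root n W rs 1 hz; rewrite /= mulr1 -Ers Cayley_Hamilton.
  have h0 (a' b' : 'I_n.+1) : bounded_sums (fun t => normc ((0 *m W ^+ t) a' b')).
    by exists 0 => T; rewrite big1 // => t _; rewrite mul0mx mxE ComplexField.Normc.normc0.
  move=> /(_ h0 a b)[c hc]; exists c => T; apply: le_trans (hc T).
  apply: ler_sum => t _; rewrite rmorph1 mul1mx -map_mx_pow mxE.
  by rewrite normc_real.
split; apply: bounded_sums_cvg0 => [t|]; first exact: fro_ge0.
pose c a b := projT1 (cid (hb a b)).
have hc a b T : \sum_(t < T) `|(F ^+ t) a b| <= c a b by exact: (projT2 (cid (hb a b))).
exists (\sum_a \sum_b c a b) => T.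
apply: (@le_trans _ _ (\sum_(t < T) \sum_a \sum_b `|(F ^+ t) a b|)).
  by apply: ler_sum => t _; exact: fro_le_sum.
rewrite exchange_big; apply: ler_sum => a _.
by rewrite exchange_big; apply: ler_sum => b _.
Qed.

End Spectral.

(** * Spectral norm and least singular value *)

Section SpectralNorm.
Variable R : realType.
Implicit Types k : R.

Lemma continuous_sum (T : topologicalType) (I : Type) (r : seq I) (f : I -> T -> R) :
  (forall i, continuous (f i)) -> continuous (fun x => \sum_(i <- r) f i x).
Proof.
move=> h; elim: r => [|i r IH] x.
  by under eq_fun do rewrite big_nil; exact: cst_continuous.
under eq_fun do rewrite big_cons.
by apply: (@continuousD _ _ _ (f i)); [exact: h|exact: IH].
Qed.

Lemma sphere_compact n : compact [set v : 'rV[R]_n | dot v v = 1].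
Proof.
have c_dot : continuous (fun v : 'rV[R]_n => dot v v : R).
  have -> : (fun v : 'rV[R]_n => dot v v) = (fun v => \sum_j v 0 j * v 0 j).
    by apply/funext => v; rewrite dotE big_ord1.
  pose f (j : 'I_n) (u : 'rV[R]_n) : R := u 0 j * u 0 j.
  have hf (j : 'I_n) : continuous (f j).
    by move=> v; apply: continuousM; exact: coord_continuous.
  exact: continuous_sum hf.
apply: (@subclosed_compact _ _ [set v : 'rV[R]_n | forall i, `[-1 : R, 1]%classic (v ord0 i)]).
- apply: (@closed_comp _ _ (fun v : 'rV[R]_n => dot v v : R) [set 1]); last exact: closed_eq.
  by move=> v _; exact: c_dot.
- apply: (@rV_compact R n (fun=> `[-1, 1]%classic)) => i; exact: segment_compact.
- move=> v /= hv i; have := entry_sqr_le v ord0 i; rewrite hv.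
  by rewrite in_itv /= -ler_norml -real_normK ?num_real // expr_le1.
Qed.

(** The minimum of the Rayleigh quotient over the unit sphere is attained, and
    the minimiser v satisfies quad (W - lambda) v = 0 with W - lambda positive
    semidefinite, so (W - lambda) v = 0 by Cauchy-Schwarz. *)
Lemma symmetric_min_eigenvalue n (W : 'M[R]_n.+1) : W^T = W ->
  exists2 a, eigenvalue W a & psd (W - a%:M).
Proof.
move=> W_sym; pose f (v : 'rV[R]_n.+1) := quad W v^T.
have cf : continuous f.
  have -> : f = (fun v => \sum_j (\sum_i v 0 i * W i j) * v 0 j).
    apply/funext => v; rewrite /f /quad trmxK mxE; apply: eq_bigr => j _.
    by rewrite !mxE.
  pose g (i j : 'I_n.+1) (u : 'rV[R]_n.+1) : R := u 0 i * W i j.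
  have hg (i j : 'I_n.+1) : continuous (g i j).
    by move=> v; apply: continuousM; [exact: coord_continuous|exact: cst_continuous].
  pose f' (j : 'I_n.+1) (u : 'rV[R]_n.+1) : R := (\sum_i g i j u) * u 0 j.
  have hf (j : 'I_n.+1) : continuous (f' j).
    move=> v; apply: continuousM; last exact: coord_continuous.
    exact: (continuous_sum (hg^~ j)).
  exact: continuous_sum hf.
have [||v0] := @compact_EVT_min _ _ f _ _ (@sphere_compact n.+1).
- exists (delta_mx 0 0); rewrite /= dot_delta mxE.
  by rewrite !eqxx.
- exact: continuous_subspaceT.
rewrite inE /= => v01 hmin; set S := W - (f v0)%:M.
have pS : psd S.
  split; first by rewrite linearB /= W_sym tr_scalar_mx.
  move=> u; rewrite quadB quad_scalar subr_ge0.
  have [u0|u0] := eqVneq (fro u) 0.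
    have -> : u = 0.
      apply/matrixP => i j; rewrite mxE; apply/eqP; rewrite -normr_le0 -u0.
      exact: entry_le.
    by rewrite quadE mulmx0 /dot mulmx0 mxtrace0 mulr0.
  have h : f v0 <= (fro u)^-1 ^+ 2 * quad W u.
    have -> : (fro u)^-1 ^+ 2 * quad W u = f ((fro u)^-1 *: u^T).
      rewrite /f linearZ /= trmxK !quadE -scalemxAr dotZl dotZr mulrA.
      by rewrite expr2.
    by apply: hmin; rewrite inE /= dotZl dotZr -frosq froT mulrA -expr2 -exprMn mulVf // expr1n.
  apply: le_trans (ler_wpM2r (dot_ge0 u) h) _; rewrite le_eqVlt; apply/orP; left.
  by apply/eqP; rewrite -frosq mulrAC -exprMn mulVf // expr1n mul1r.
exists (f v0) => //; apply/eigenvalueP; exists v0; last first.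
  apply/eqP => v00; move/eqP: v01; rewrite v00 /dot mulmx0 mxtrace0.
  by rewrite eq_sym oner_eq0.
have Sv0 : S *m v0^T = 0.
  apply/matrixP => i j; rewrite [RHS]mxE; apply/eqP; rewrite -sqrf_eq0 eq_le sqr_ge0 andbT.
  rewrite (ord1 j) -[(S *m _) i 0]dot_delta dotC; apply: le_trans (psd_cauchy _ _ pS) _.
  rewrite [X in _ * X]quadB quad_scalar -[quad W _]/(f v0).
  by rewrite -frosq froT frosq v01 mulr1 subrr mulr0.
move: (congr1 trmx Sv0); rewrite trmx_mul trmxK pS.1 trmx0 mulmxBr mul_mx_scalar.
by move/eqP; rewrite subr_eq0 => /eqP.
Qed.

Lemma symmetric_max_eigenvalue n (W : 'M[R]_n.+1) : W^T = W ->
  exists2 a, eigenvalue W a & psd (a%:M - W).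
Proof.
move=> W_sym; have [|a] := @symmetric_min_eigenvalue n (- W).
  by rewrite linearN /= W_sym.
move=> /eigenvalueP[v hv v0] ha; exists (- a).
  apply/eigenvalueP; exists v => //.
  by rewrite -[W]opprK mulmxN hv scaleNr.
by rewrite -scalemx1 scaleNr scalemx1 addrC.
Qed.

Lemma eigenvalue_symmetric n (W : 'M[R]_n) a : W^T = W -> eigenvalue W a ->
  exists2 v : 'cV[R]_n, 0 < dot v v & quad W v = a * dot v v.
Proof.
move=> W_sym /eigenvalueP[v hv v0]; exists v^T; last first.
  by rewrite quadE -[W]W_sym -trmx_mul hv linearZ /= dotZr.
rewrite lt_def dot_ge0 andbT; apply: contra_neq v0 => h; apply/rowP => j.
rewrite mxE; apply/eqP; rewrite -sqrf_eq0 eq_le sqr_ge0 andbT -h.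
by rewrite -frosq froT frosq entry_sqr_le.
Qed.

Lemma eigenvalue_gram m n (W : 'M[R]_(m, n)) a : eigenvalue (W^T *m W) a ->
  exists2 v : 'cV[R]_n, 0 < dot v v & dot (W *m v) (W *m v) = a * dot v v.
Proof.
move=> /(eigenvalue_symmetric (psd_gram W).1)[v v0 hv]; exists v => //.
by rewrite -hv quadE /dot trmx_mul !mulmxA.
Qed.

(** The largest eigenvalue gives an upper bound of the set of singular values;
    without one its supremum would carry no information. *)
Lemma has_sup_singular_values m n (W : 'M[R]_(m, n.+1)) :
  exists2 a, eigenvalue (W^T *m W) a &
    psd (a%:M - W^T *m W) /\ ubound (singular_values W) (Num.sqrt a).
Proof.
have [a ha pa] := symmetric_max_eigenvalue (psd_gram W).1; exists a => //; split=> //.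
move=> _ [b hb <-]; apply: ler_wsqrtr.
have [v v0 hv] := eigenvalue_gram hb; rewrite -(ler_pM2r v0) -hv.
have := pa.2 v; rewrite quadB quad_scalar subr_ge0; apply: le_trans.
by rewrite quadE /dot trmx_mul !mulmxA.
Qed.

Lemma specnorm_ge0 m n (W : 'M[R]_(m, n)) : 0 <= specnorm W.
Proof.
rewrite /specnorm; have [->|/set0P[x hx]] := eqVneq (singular_values W) set0.
  by rewrite sup0.
case: n W hx => [W [a]|n W hx].
  move=> /eigenvalueP[v hv]; rewrite [v]thinmx0.
  by rewrite eqxx.
have [a _ [_ hb]] := has_sup_singular_values W.
apply: (@le_trans _ _ x); first by case: hx => b _ <-; exact: sqrtr_ge0.
by apply: sup_upper_bound => //; split; [exists x|exists (Num.sqrt a)].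
Qed.

Lemma specnorm_le m n (W : 'M[R]_(m, n)) (v : 'cV[R]_n) :
  fro (W *m v) <= specnorm W * fro v.
Proof.
case: n W v => [W v|n W v].
  by rewrite [v]flatmx0 mulmx0 !fro0 mulr0.
apply: fro_le; first by rewrite mulr_ge0 ?fro_ge0 ?specnorm_ge0.
have [a ha [pa hb]] := has_sup_singular_values W.
have a_ge0 : 0 <= a.
  have [u u0 hu] := eigenvalue_gram ha.
  by rewrite -(pmulr_lge0 _ u0) -hu dot_ge0.
have h : a <= specnorm W ^+ 2.
  rewrite -[leLHS]sqr_sqrtr // ler_pXn2r ?nnegrE ?sqrtr_ge0 ?specnorm_ge0 //.
  apply: sup_upper_bound; last by exists a.
  by split; [exists (Num.sqrt a), a|exists (Num.sqrt a)].
rewrite exprMn frosq; apply: le_trans (ler_wpM2r (dot_ge0 v) h).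
have := pa.2 v; rewrite quadB quad_scalar subr_ge0; apply: le_trans.
by rewrite quadE /dot trmx_mul !mulmxA.
Qed.

(** |W^T w|^2 = <w, W (W^T w)> is at most |w| |W| |W^T w|. *)
Lemma specnorm_tr_le m n (W : 'M[R]_(m, n)) (w : 'cV[R]_m) :
  fro (W^T *m w) <= specnorm W * fro w.
Proof.
have [h0|h0] := eqVneq (fro (W^T *m w)) 0.
  by rewrite h0 mulr_ge0 ?fro_ge0 ?specnorm_ge0.
have {h0} h0 : 0 < fro (W^T *m w) by rewrite lt_def h0 fro_ge0.
rewrite -(ler_pM2r h0) -expr2 frosq.
have -> : dot (W^T *m w) (W^T *m w) = dot w (W *m (W^T *m w)).
  by rewrite /dot trmx_mul trmxK !mulmxA.
apply: le_trans (ler_norm _) _; apply: le_trans (dot_le _ _) _.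
by rewrite mulrAC mulrC ler_wpM2r ?fro_ge0 // specnorm_le.
Qed.

(** Summing the bound over the columns produces the number of columns; summing
    it over the rows instead produces the number of rows. *)
Lemma dot_le_specnorm m n (W : 'M[R]_(m, n)) :
  dot W W <= (minn m n)%:R * specnorm W ^+ 2.
Proof.
have h p q (A : 'M[R]_(p, q)) : (forall v : 'cV_q, fro (A *m v) <= specnorm W * fro v) ->
    dot A A <= q%:R * specnorm W ^+ 2.
  move=> h; rewrite dot_cols mulr_natl -[X in _ *+ X]card_ord -sumr_const.
  apply: ler_sum => j _; rewrite -frosq colE.
  rewrite ler_pXn2r ?nnegrE ?fro_ge0 ?specnorm_ge0 //.
  by apply: le_trans (h _) _; rewrite fro_delta mulr1.
have [mn|mn] := leqP m n; last by apply: h; exact: specnorm_le.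
rewrite -frosq -froT frosq; apply: h; exact: specnorm_tr_le.
Qed.

Lemma specnorm_psd n (W : 'M[R]_n) : W^T = W -> psd ((specnorm W)%:M - W).
Proof.
move=> W_sym; split; first by rewrite linearB /= W_sym tr_scalar_mx.
move=> v; rewrite quadB quad_scalar subr_ge0 quadE.
apply: le_trans (ler_norm _) _; apply: le_trans (dot_le _ _) _.
by rewrite -frosq expr2 mulrA (mulrC (specnorm W)) -mulrA ler_wpM2l ?fro_ge0 // specnorm_le.
Qed.

(** The least eigenvalue a of W is nonnegative, so a is the square root of the
    eigenvalue a^2 of W^T W. *)
Lemma sigma_min_psd n (W : 'M[R]_n) : (0 < n)%N -> psd W ->
  psd (W - (sigma_min W)%:M).
Proof.
case: n W => // n W _ pW; have [a ha pa] := symmetric_min_eigenvalue pW.1.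
have a0 : 0 <= a.
  have [v v0 hv] := eigenvalue_symmetric pW.1 ha.
  by rewrite -(pmulr_lge0 _ v0) -hv pW.2.
have -> : W - (sigma_min W)%:M = (W - a%:M) + (a - sigma_min W)%:M.
  by rewrite raddfB addrA subrK.
apply: psdD => //; apply: psd_scalar; rewrite subr_ge0.
apply: ge_inf; first by exists 0 => _ [b _ <-]; exact: sqrtr_ge0.
exists (a ^+ 2); last by rewrite sqrtr_sqr ger0_norm.
have /eigenvalueP[v hv v0] := ha; apply/eigenvalueP; exists v => //.
by rewrite pW.1 mulmxA hv -scalemxAl hv scalerA expr2.
Qed.

Lemma sigma_min_posdef n (W : 'M[R]_n) : (0 < n)%N -> posdef W -> 0 < sigma_min W.
Proof.
case: n W => // n W _ W_pos; have pW := posdef_psd W_pos.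
have [a ha pa] := symmetric_min_eigenvalue pW.1.
have a0 : 0 < a.
  have [v v0 hv] := eigenvalue_symmetric pW.1 ha.
  rewrite -(pmulr_lgt0 _ v0) -hv; apply: W_pos.2; apply: contraTneq v0 => ->.
  by rewrite /dot mulmx0 mxtrace0 ltxx.
apply: (lt_le_trans a0); apply: lb_le_inf.
  have [b hb _] := symmetric_max_eigenvalue (psd_gram W).1.
  by exists (Num.sqrt b), b.
move=> _ [b hb <-]; have [v v0 hv] := eigenvalue_gram hb.
have h : a * fro v <= fro (W *m v).
  have := le_trans (psd_ge v pa) (ler_norm _); rewrite quadE.
  move=> /le_trans/(_ (dot_le _ _)); rewrite -frosq expr2 mulrA mulrC.
  by rewrite ler_pM2l // lt_def fro_ge0 andbT; apply: contraTneq v0 => h; rewrite -frosq h expr0n ltxx.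
have -> : a = Num.sqrt (a ^+ 2) by rewrite sqrtr_sqr ger0_norm ?ltW.
apply: ler_wsqrtr.
rewrite -(ler_pM2r v0) -hv -!frosq -exprMn.
by rewrite ler_pXn2r ?nnegrE ?fro_ge0 // mulr_ge0 ?fro_ge0 ?ltW.
Qed.

End SpectralNorm.

(** * The cost and the state covariance as solutions of Lyapunov equations *)

(** The two Lyapunov equations are adjoint to each other, which turns a cost
    written with the cost-to-go matrix into one written with the covariance. *)
Lemma lyap_dual (R : realType) n (F X S0 Pk S : 'M[R]_n) :
  Pk = X + F^T *m Pk *m F -> S = S0 + F *m S *m F^T ->
  \tr (Pk *m S0) = \tr (X *m S).
Proof.
move=> hP hS; have -> : X = Pk - F^T *m Pk *m F by rewrite {1}hP addrK.
have -> : S0 = S - F *m S *m F^T by rewrite {1}hS addrK.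
rewrite mulmxBr mulmxBl !linearB /=; congr (_ - _).
by rewrite -!mulmxA [RHS]mxtrace_mulC !mulmxA.
Qed.

(** The partial sums telescope to quad L x - quad L (F^t x), where L solves the
    Lyapunov equation.  The sum is thus a quadratic form in x, and its average
    over x involves second moments only. *)
Lemma quad_series (R : realType) n (F W : 'M[R]_n) (x : 'cV[R]_n) : pow_cvg0 F ->
  (\sum_(0 <= t <oo) (quad W (F ^+ t *m x))%:E = (quad (lyap F^T W) x)%:E)%E.
Proof.
move=> hF; have [cF] := hF; have hL := lyapE W (pow_cvg0_tr hF).
have e T : \sum_(0 <= t < T) quad W (F ^+ t *m x)
    = quad (lyap F^T W) x - quad (lyap F^T W) (F ^+ T *m x).
  have h := congr1 (fun Z => quad Z x) (lyap_unroll T hL).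
  rewrite {1}h quadD -trmx_exp trmxK quad_conjT addrK big_mkord.
  elim/big_rec2: _ => [|t y Z _ ->]; first by rewrite /quad mulmx0 mul0mx mxE.
  by rewrite quadD -trmx_exp trmxK quad_conjT.
apply/cvg_lim => //; under eq_fun do rewrite sumEFin e.
apply/cvg_EFin; first by near=> t.
rewrite -[X in _ --> X]subr0; apply: cvgB; first exact: cvg_cst.
apply: norm_cvg0; apply: (@squeeze0 _ _ (fun t => fro (F ^+ t) * fro (F ^+ t))
  (fro x ^+ 2 * fro (lyap F^T W))).
  move=> t; rewrite normr_ge0 /= quadE; apply: le_trans (dot_le _ _) _.
  have h := fro_mul (F ^+ t) x; have := fro_mul (lyap F^T W) (F ^+ t *m x).
  have := fro_ge0 (F ^+ t *m x); have := fro_ge0 (lyap F^T W); set a := fro (F ^+ t *m x).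
  set b := fro (lyap _ _) => b0 a0 hb.
  have h2 : a ^+ 2 <= (fro (F ^+ t) * fro x) ^+ 2.
    by rewrite ler_pXn2r ?nnegrE ?mulr_ge0 ?fro_ge0.
  apply: le_trans (ler_wpM2l a0 hb) _; rewrite mulrCA -expr2.
  by apply: le_trans (ler_wpM2l b0 h2) _; rewrite le_eqVlt; apply/orP; left; apply/eqP; ring.
by rewrite -(mulr0 0); apply: cvgM.
Unshelve. all: by end_near. Qed.

Lemma quad_delta_mx (R : realType) n (a b : 'I_n) (x : 'cV[R]_n) :
  quad (delta_mx a b) x = x a 0 * x b 0.
Proof.
rewrite /quad -(mul_delta_mx (0 : 'I_1)) mulmxA -colE -mulmxA -rowE.
by rewrite mxE big_ord1 !mxE.
Qed.

Section Cost.
Variables (R : realType) (M nx nu : nat) (P : fedlqr R M nx nu).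

Lemma state_pow i K x t : state P i K x t = closed_loop P i K ^+ t *m x.
Proof.
elim: t => [|t IH] /=; first by rewrite expr0 mul1mx.
by rewrite IH exprS -mulmxE /input /closed_loop mulNmx mulmxN mulmxBl mulmxBl !mulmxA.
Qed.

Definition cost_mx (K : 'M[R]_(nu, nx)) := costQ P + K^T *m costR P *m K.

Definition value_mx i K := lyap (closed_loop P i K)^T (cost_mx K).

Definition cov_mx i K := lyap (closed_loop P i K) (Sigma0 P).

(** The sign of the feedback disappears in the quadratic input cost. *)
Lemma stage_costE K x :
  quad (costQ P) x + quad (costR P) (input K x) = quad (cost_mx K) x.
Proof.
rewrite quadD quad_conjT; congr (_ + _).
by rewrite /input mulNmx !quadE mulmxN dotNr dotNl opprK.
Qed.

Lemma costE i K : cost P i K =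
  (\int[init P]_x0 \sum_(0 <= t <oo)
     (quad (cost_mx K) (closed_loop P i K ^+ t *m col_of_tuple x0))%:E)%E.
Proof.
apply: eq_integral => x0 _; apply: eq_eseriesr => t _ /=.
by rewrite stage_costE state_pow.
Qed.

Record regular : Prop := Regular {
  init_bounded : exists H, {ae init P, forall x0, l2norm (col_of_tuple x0) <= H} ;
  costQ_posdef : posdef (costQ P) ;
  costR_posdef : posdef (costR P) ;
  mu_gt0 : 0 < mu P ;
  nx_gt0 : (0 < nx)%N ;
  nu_gt0 : (0 < nu)%N }.

Hypothesis hP : regular.

Lemma measurable_coord_mul (a b : 'I_nx) :
  measurable_fun setT (fun x0 : nx.-tuple R => tnth x0 a * tnth x0 b).
Proof. by apply: measurable_funM; exact: measurable_tnth. Qed.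

Lemma measurable_quad (Z : 'M[R]_nx) :
  measurable_fun setT (fun x0 : nx.-tuple R => quad Z (col_of_tuple x0)).
Proof.
have -> : (fun x0 : nx.-tuple R => quad Z (col_of_tuple x0)) =
    (fun x0 => \sum_b (\sum_a tnth x0 a * Z a b) * tnth x0 b).
  apply/funext => x0; rewrite /quad mxE; apply: eq_bigr => b _; rewrite !mxE.
  by congr (_ * _); apply: eq_bigr => a _; rewrite !mxE.
apply: measurable_sum => b; apply: measurable_funM; last exact: measurable_tnth.
apply: measurable_sum => a; apply: measurable_funM; first exact: measurable_tnth.
exact: measurable_cst.
Qed.

Lemma integrable_coord_mul (a b : 'I_nx) :
  (init P).-integrable setT (fun x0 => (tnth x0 a * tnth x0 b)%:E).
Proof.
have mf := measurable_coord_mul a b; have [H hH] := init_bounded hP.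
apply/integrableP; split; first exact/measurable_EFinP.
apply: (@le_lt_trans _ _ (\int[init P]_x0 (cst (H ^+ 2)%:E) x0)%E); last first.
  rewrite integral_cst //= probability_setT mule1.
  exact: ltry.
apply: ae_ge0_le_integral => //.
- by apply: measurableT_comp => //; exact/measurable_EFinP.
- by move=> x _ /=; rewrite lee_fin sqr_ge0.
apply: filterS hH => x0 hx _ /=; rewrite lee_fin normrM.
have h c : `|tnth x0 c| <= H.
  apply: le_trans hx; rewrite -sqrtr_sqr; apply: ler_wsqrtr.
  by rewrite (bigD1 c) //= mxE lerDl; apply: sumr_ge0 => d _; exact: sqr_ge0.
by rewrite expr2; apply: ler_pM.
Qed.

Lemma integral_quad (Z : 'M[R]_nx) :
  (\int[init P]_x0 (quad Z (col_of_tuple x0))%:E = (\tr (Z *m Sigma0 P))%:E)%E.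
Proof.
have S0E a b : (\int[init P]_x0 (tnth x0 a * tnth x0 b)%:E = (Sigma0 P a b)%:E)%E.
  rewrite mxE unlock fineK //.
  by apply: integrable_fin_num => //; exact: integrable_coord_mul.
under eq_integral => x0 _.
  have -> : (quad Z (col_of_tuple x0))%:E =
      (\sum_a \sum_b (Z a b)%:E * (tnth x0 b * tnth x0 a)%:E)%E.
    rewrite quadE dotE -sumEFin; apply: eq_bigr => a _.
    rewrite big_ord1 !mxE mulr_sumr -sumEFin; apply: eq_bigr => b _.
    by rewrite !mxE -EFinM; congr EFin; ring.
  over.
have iab a b : (init P).-integrable setT
    (fun x0 => (Z a b)%:E * (tnth x0 b * tnth x0 a)%:E)%E.
  by apply: integrableZl => //; exact: integrable_coord_mul.
rewrite integral_sum //; last by move=> a; exact: integrable_sum.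
rewrite -sumEFin; apply: eq_bigr => a _.
rewrite integral_sum // mxE -sumEFin; apply: eq_bigr => b _.
rewrite integralZl //; last exact: integrable_coord_mul.
by rewrite S0E -EFinM.
Qed.

Lemma Sigma0_sym : (Sigma0 P)^T = Sigma0 P.
Proof.
apply/matrixP => a b; rewrite !mxE; congr (fine 'E_(_)[_]).
by apply/funext => x0; rewrite mulrC.
Qed.

Lemma Sigma0_psd : psd (Sigma0 P).
Proof.
split=> [|v]; first exact: Sigma0_sym.
rewrite quad_tr mxtrace_mulC -lee_fin -integral_quad.
apply: integral_ge0 => x0 _; rewrite lee_fin.
rewrite -[v *m v^T]/(v *m v^T) -[v in v *m _]trmxK.
exact: (psd_gram _).2.
Qed.

Lemma cost_stable i K : pow_cvg0 (closed_loop P i K) ->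
  cost P i K = (\tr (value_mx i K *m Sigma0 P))%:E.
Proof.
move=> hF; rewrite costE -integral_quad; apply: eq_integral => x0 _.
exact: quad_series.
Qed.

(** The entry (a, b) of the covariance is the total cost for the weight matrix
    delta_mx a b, and can be read off the adjoint equation. *)
Lemma SigmaK_stable i K : pow_cvg0 (closed_loop P i K) -> SigmaK P i K = cov_mx i K.
Proof.
move=> hF; apply/matrixP => a b; rewrite mxE.
transitivity (\tr (lyap (closed_loop P i K)^T (delta_mx a b) *m Sigma0 P)).
  rewrite -[RHS]/(fine _%:E) -integral_quad; congr fine.
  apply: eq_integral => x0 _; rewrite -quad_series //.
  by apply: eq_eseriesr => t _ /=; rewrite state_pow quad_delta_mx.
have hL := lyapE (delta_mx a b) (pow_cvg0_tr hF); rewrite trmxK in hL.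
rewrite (lyap_dual hL (lyapE (Sigma0 P) hF)) -(trmxK (delta_mx a b)) -/(dot _ _).
by rewrite trmx_delta dotC dot_delta -[in LHS](lyap_tr hF Sigma0_sym) mxE.
Qed.

Lemma cost_mx_ge K : psd (cost_mx K - (sigma_min (costQ P))%:M).
Proof.
rewrite /cost_mx addrAC; apply: psdD; last first.
  exact/psd_conjT/posdef_psd/(costR_posdef hP).
exact: sigma_min_psd (nx_gt0 hP) (posdef_psd (costQ_posdef hP)).
Qed.

Lemma cost_mx_psd K : psd (cost_mx K).
Proof.
apply: psdD; first exact: posdef_psd (costQ_posdef hP).
exact/psd_conjT/posdef_psd/(costR_posdef hP).
Qed.

Lemma cost_ge0 i K : (0 <= cost P i K)%E.
Proof.
rewrite costE; apply: integral_ge0 => x0 _; apply: nneseries_ge0 => t _ _.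
by rewrite lee_fin (cost_mx_psd K).2.
Qed.

Lemma Sigma0_ge : psd (Sigma0 P - (mu P)%:M).
Proof. exact: sigma_min_psd (nx_gt0 hP) Sigma0_psd. Qed.

(** A finite cost forces stability: the partial sums of the cost dominate
    those of the |F^t|^2, since Q and the initial covariance are bounded
    below. *)
Lemma cost_fin_pow_cvg0 i K : (cost P i K < +oo)%E -> pow_cvg0 (closed_loop P i K).
Proof.
set F := closed_loop P i K => hfin; apply: bounded_sums_pow_cvg0.
have q0 := sigma_min_posdef (nx_gt0 hP) (costQ_posdef hP); have m0 := mu_gt0 hP.
exists (fine (cost P i K) / (sigma_min (costQ P) * mu P)) => T.
rewrite ler_pdivlMr ?mulr_gt0 // -lee_fin fineK; last first.
  by rewrite ge0_fin_numE // cost_ge0.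
pose Z := \sum_(t < T) ((F ^+ t)^T *m cost_mx K *m F ^+ t).
apply: (@le_trans _ _ (\tr (Z *m Sigma0 P))%:E).
  rewrite lee_fin mulmx_suml linear_sum mulr_suml /=; apply: ler_sum => t _.
  have -> : \tr ((F ^+ t)^T *m cost_mx K *m F ^+ t *m Sigma0 P)
      = \tr (cost_mx K *m (F ^+ t *m Sigma0 P *m (F ^+ t)^T)).
    by rewrite -!mulmxA mxtrace_mulC !mulmxA.
  apply: le_trans _ (tr_psd_mul_ge (cost_mx_ge K) (psd_conj _ Sigma0_psd)).
  rewrite mulrCA ler_wpM2l ?(ltW q0) //.
  have -> : \tr (F ^+ t *m Sigma0 P *m (F ^+ t)^T) = \tr (Sigma0 P *m ((F ^+ t)^T *m F ^+ t)).
    by rewrite -!mulmxA mxtrace_mulC !mulmxA.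
  by rewrite frosq mulrC; exact: tr_psd_mul_ge Sigma0_ge (psd_gram _).
have quad_Z x : quad Z x = \sum_(0 <= t < T) quad (cost_mx K) (F ^+ t *m x).
  rewrite big_mkord quad_tr /Z mulmx_suml linear_sum /=; apply: eq_bigr => t _.
  by rewrite -quad_tr quad_conjT.
rewrite -integral_quad costE.
have c0 t x0 : (0 <= (quad (cost_mx K) (F ^+ t *m col_of_tuple x0))%:E)%E.
  by rewrite lee_fin (cost_mx_psd K).2.
apply: ge0_le_integral => //.
- move=> x0 _; rewrite quad_Z lee_fin; apply: sumr_ge0 => t _.
  exact: (cost_mx_psd K).2.
- by apply/measurable_EFinP; exact: measurable_quad.
- apply: ge0_emeasurable_sum => // t _; apply/measurable_EFinP.
  rewrite (_ : (fun x0 => _) = (fun x0 : nx.-tuple R =>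
    quad ((F ^+ t)^T *m cost_mx K *m F ^+ t) (col_of_tuple x0))).
    exact: measurable_quad.
  by apply/funext => x0; rewrite quad_conjT.
move=> x0 _; rewrite quad_Z -sumEFin; apply: nneseries_lim_ge => t _ _.
exact: c0.
Qed.

End Cost.

(** * Perturbation of Lyapunov equations *)

Section Perturbation.
Variables (R : realType) (n : nat).
Variables (F F' X S : 'M[R]_n) (m : R).
Hypotheses (m_gt0 : 0 < m) (S_psd : psd S) (X_ge : psd (X - m%:M)).
Hypothesis S_lyap : S = X + F *m S *m F^T.
Let Y := F' *m S *m F'^T - F *m S *m F^T.
Hypothesis Y_small : fro Y <= m / 2.

Let Y_sym : Y^T = Y.
Proof. by rewrite linearB /= !trmx_mul !trmxK !mulmxA S_psd.1. Qed.

(** The unperturbed solution S is still a Lyapunov function for F'. *)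
Lemma perturb_pow_cvg0 : pow_cvg0 F'.
Proof.
apply: (@lyapunov_pow_cvg0 _ _ _ S (m / 2)) => //; first by rewrite divr_gt0.
have -> : S - F' *m S *m F'^T - (m / 2)%:M = (X - m%:M) + ((m / 2)%:M - Y).
  have -> : (m%:M : 'M[R]_n) = (m / 2)%:M + (m / 2)%:M by rewrite -raddfD -splitr.
  rewrite {1}S_lyap /Y; move: (F *m _ *m _) (F' *m _ *m _) => A B.
  by apply/matrixP => i j; rewrite !mxE; ring.
by apply: psdD => //; apply: fro_psd.
Qed.

(** Comparison: kappa S - (S' - S) solves the perturbed equation with a
    positive semidefinite right-hand side as soon as kappa m / 2 dominates the
    perturbation of the data. *)
Lemma perturb_lyap (X' S' : 'M[R]_n) : X'^T = X' -> X^T = X ->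
  S' = X' + F' *m S' *m F'^T ->
  fro (S' - S) <= n%:R * (2 / m * (fro (X' - X) + fro Y) * \tr S).
Proof.
move=> X'_sym X_sym S'_lyap; have F'0 := perturb_pow_cvg0.
set a := fro (X' - X); set b := fro Y; pose k := 2 / m * (a + b).
have k0 : 0 <= k by rewrite mulr_ge0 ?addr_ge0 ?fro_ge0 // divr_ge0 // ltW.
have key (s : R) : s = 1 \/ s = -1 -> psd (k *: S + s *: (S' - S)).
  (* The sign s treats both sides of the sandwich at once. *)
  move=> hs; apply: (lyap_psd F'0 (X := k *: (X - Y) + s *: (X' - X + Y))).
    rewrite mulmxDr mulmxDl -!scalemxAr -!scalemxAl mulmxBr mulmxBl.
    have e1 : F' *m S *m F'^T = S - X + Y by rewrite /Y {2}S_lyap; apply/matrixP => i j; rewrite !mxE; ring.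
    have e2 : F' *m S' *m F'^T = S' - X' by rewrite [X in _ = X - _]S'_lyap addrAC subrr add0r.
    by rewrite e1 e2; apply/matrixP => i j; rewrite !mxE; ring.
  have -> : k *: (X - Y) + s *: (X' - X + Y) =
    k *: (X - m%:M) + k *: ((m / 2)%:M - Y) + (a%:M - - s *: (X' - X)) + (b%:M - - s *: Y).
    have -> : (m%:M : 'M[R]_n) = (m / 2)%:M + (m / 2)%:M by rewrite -raddfD -splitr.
    have : (a%:M + b%:M : 'M[R]_n) = k *: (m / 2)%:M.
      rewrite -raddfD scale_scalar_mx /=; congr (_%:M).
      by rewrite /k; field; rewrite gt_eqF.
    move: (m / 2)%:M (b%:M) (a%:M) => N b' a' /(canRL (addrK _)) ->.
    by apply/matrixP => p q; rewrite !mxE; ring.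
  have fros (Z : 'M[R]_n) : fro (- s *: Z) = fro Z.
    by rewrite froZ normrN; case: hs => ->; rewrite ?normrN normr1 mul1r.
  apply: psdD; [apply: psdD; [apply: psdD|]|].
  - exact: psdZ.
  - by apply: psdZ => //; apply: fro_psd.
  - by apply: fro_psd; rewrite ?fros // linearZ /= linearB /= X_sym X'_sym.
  - by apply: fro_psd; rewrite ?fros // linearZ /= Y_sym.
have := key 1 (or_introl erefl); have := key (-1) (or_intror erefl).
rewrite scale1r scaleN1r => h1 h2.
by apply: le_trans (psd_sandwich h1 h2) _; rewrite mxtraceZ.
Qed.

End Perturbation.

(** * Uniform estimates *)

Section UniformO.
Variables (R : realType) (T : Type) (D : set T) (d : T -> R).
Hypothesis d_ge0 : forall t, D t -> 0 <= d t.

(** f = O(d^k), uniformly over the set D and with no limit involved: the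
    estimates must hold on a whole sublevel set. *)
Definition unifO (k : nat) m n (f : T -> 'M[R]_(m, n)) : Prop :=
  exists2 c : R, 0 <= c & forall t, D t -> fro (f t) <= c * d t ^+ k.

Lemma unifO_cst m n (A : 'M[R]_(m, n)) : unifO 0 (fun=> A).
Proof. by exists (fro A) => [|t _]; rewrite ?fro_ge0 // mulr1. Qed.

Lemma unifOD k m n (f g : T -> 'M[R]_(m, n)) :
  unifO k f -> unifO k g -> unifO k (fun t => f t + g t).
Proof.
move=> [a a0 ha] [b b0 hb]; exists (a + b) => [|t Dt]; first exact: addr_ge0.
by rewrite mulrDl; apply: le_trans (froD _ _) _; rewrite lerD ?ha ?hb.
Qed.

Lemma unifOZ k m n (a : R) (f : T -> 'M[R]_(m, n)) :
  unifO k f -> unifO k (fun t => a *: f t).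
Proof.
move=> [c c0 hc]; exists (`|a| * c) => [|t Dt]; first by rewrite mulr_ge0.
by rewrite froZ -mulrA ler_wpM2l ?hc.
Qed.

Lemma unifON k m n (f : T -> 'M[R]_(m, n)) : unifO k f -> unifO k (fun t => - f t).
Proof. by move=> [c c0 hc]; exists c => // t Dt; rewrite froN hc. Qed.

Lemma unifOB k m n (f g : T -> 'M[R]_(m, n)) :
  unifO k f -> unifO k g -> unifO k (fun t => f t - g t).
Proof. by move=> hf hg; apply: unifOD => //; apply: unifON. Qed.

Lemma unifOM j k m n p (f : T -> 'M[R]_(m, n)) (g : T -> 'M[R]_(n, p)) :
  unifO j f -> unifO k g -> unifO (j + k) (fun t => f t *m g t).
Proof.
move=> [a a0 ha] [b b0 hb]; exists (a * b) => [|t Dt]; first exact: mulr_ge0.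
rewrite exprD mulrACA; apply: le_trans (fro_mul _ _) _.
by apply: ler_pM; rewrite ?fro_ge0 ?ha ?hb.
Qed.

Lemma unifO_tr k m n (f : T -> 'M[R]_(m, n)) : unifO k f -> unifO k (fun t => (f t)^T).
Proof. by move=> [c c0 hc]; exists c => // t Dt; rewrite froT hc. Qed.

Lemma unifO_eq k m n (f g : T -> 'M[R]_(m, n)) :
  (forall t, D t -> f t = g t) -> unifO k f -> unifO k g.
Proof. by move=> e [c c0 hc]; exists c => // t Dt; rewrite -e ?hc. Qed.

Lemma unifO_weaken k m n (f : T -> 'M[R]_(m, n)) : (forall t, D t -> d t <= 1) ->
  unifO k f -> unifO 0 f.
Proof.
move=> d1 [c c0 hc]; exists c => // t Dt; apply: le_trans (hc t Dt) _.
by rewrite ler_wpM2l // exprn_ile1 ?d_ge0 ?d1.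
Qed.

Lemma unifO_psd n (f : T -> 'M[R]_n) c : 
  (forall t, D t -> psd (f t) /\ \tr (f t) <= c) -> unifO 0 f.
Proof.
move=> h; exists (n%:R * Num.max c 0) => [|t Dt]; first by rewrite mulr_ge0 // le_max lexx orbT.
have [pf tf] := h t Dt; rewrite mulr1; apply: le_trans (psd_fro pf) _.
by rewrite ler_wpM2l // le_max tf.
Qed.

Lemma unifO_mxtrace k n (f : T -> 'M[R]_n) : unifO k f ->
  exists2 c : R, 0 <= c & forall t, D t -> `|\tr (f t)| <= c * d t ^+ k.
Proof.
move=> [c c0 hc]; exists (c * fro (1%:M : 'M[R]_n)) => [|t Dt]; first by rewrite mulr_ge0 ?fro_ge0.
rewrite -[f t]mulmx1 mulrAC; apply: le_trans (tr_mul_le _ _) _.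
by rewrite ler_wpM2r ?fro_ge0 ?hc.
Qed.

End UniformO.

Lemma unifO_sub (R : realType) (T : Type) (D D' : set T) (d : T -> R) k m n
    (f : T -> 'M[R]_(m, n)) :
  D' `<=` D -> unifO D d k f -> unifO D' d k f.
Proof. by move=> DD [c c0 hc]; exists c => // t /DD; apply: hc. Qed.

(** * The policy gradient *)

Section Gradient.
Variables (R : realType) (M nx nu : nat) (P : fedlqr R M nx nu).
Hypothesis hP : regular P.
Variable i : 'I_M.

Local Notation F := (closed_loop P i).
Local Notation V := (value_mx P i).
Local Notation S := (cov_mx P i).
Local Notation A := (sysA P i).
Local Notation B := (sysB P i).
Local Notation stable K := (pow_cvg0 (F K)).

Lemma sigma_minQ_gt0 : 0 < sigma_min (costQ P).
Proof. exact: sigma_min_posdef (nx_gt0 hP) (costQ_posdef hP). Qed.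

Lemma sigma_minR_gt0 : 0 < sigma_min (costR P).
Proof. exact: sigma_min_posdef (nu_gt0 hP) (costR_posdef hP). Qed.

Definition cost_fun K : R := \tr (V K *m Sigma0 P).

(** The natural policy gradient, up to the factor 2. *)
Definition half_grad K := costR P *m K - B^T *m V K *m F K.

Definition grad_mx K := 2 *: (half_grad K *m S K).

Lemma value_lyap K : stable K -> V K = cost_mx P K + (F K)^T *m V K *m F K.
Proof. by move=> hK; rewrite {1}/value_mx {1}(lyapE _ (pow_cvg0_tr hK)) trmxK. Qed.

Lemma cov_lyap K : stable K -> S K = Sigma0 P + F K *m S K *m (F K)^T.
Proof. exact: lyapE. Qed.

Lemma value_psd K : stable K -> psd (V K).
Proof.
move=> hK; apply: (lyap_psd (pow_cvg0_tr hK)); last exact: cost_mx_psd hP K.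
by rewrite trmxK -value_lyap.
Qed.

Lemma cov_psd K : stable K -> psd (S K).
Proof. by move=> hK; apply: lyap_psd hK (cov_lyap hK) (Sigma0_psd hP). Qed.

Lemma cov_ge K : stable K -> psd (S K - (mu P)%:M).
Proof.
move=> hK; rewrite cov_lyap // addrAC; apply: psdD; first exact: Sigma0_ge.
exact/psd_conj/cov_psd.
Qed.

Lemma cost_funE K : stable K -> cost P i K = (cost_fun K)%:E.
Proof. by move=> hK; rewrite (cost_stable hP). Qed.

Lemma cost_le_stable K (c : R) : (cost P i K <= c%:E)%E -> stable K.
Proof.
move=> hc; apply: (cost_fin_pow_cvg0 hP).
by apply: le_lt_trans hc _; exact: ltry.
Qed.

Lemma cost_fun_cov K : stable K -> cost_fun K = \tr (cost_mx P K *m S K).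
Proof. by move=> hK; exact: lyap_dual (value_lyap hK) (cov_lyap hK). Qed.

Lemma mu_tr_value_le K : stable K -> mu P * \tr (V K) <= cost_fun K.
Proof.
move=> hK; rewrite /cost_fun mxtrace_mulC.
exact: tr_psd_mul_ge (Sigma0_ge hP) (value_psd hK).
Qed.

Lemma sigma_minQ_tr_cov_le K : stable K -> sigma_min (costQ P) * \tr (S K) <= cost_fun K.
Proof.
move=> hK; rewrite cost_fun_cov //.
exact: tr_psd_mul_ge (cost_mx_ge hP K) (cov_psd hK).
Qed.

(** The covariance dominates mu, so the input cost alone controls the gain:
    sublevel sets of the cost are bounded. *)
Lemma gain_sqr_le K : stable K ->
  mu P * sigma_min (costR P) * fro K ^+ 2 <= cost_fun K.
Proof.
move=> hK; rewrite cost_fun_cov // /cost_mx mulmxDl linearD /=.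
have h1 : 0 <= \tr (costQ P *m S K).
  by apply: tr_psd_mul_ge0; [exact: posdef_psd (costQ_posdef hP)|exact: cov_psd].
have h2 := tr_psd_mul_ge (cov_ge hK) (psd_conjT K (posdef_psd (costR_posdef hP))).
have h3 := tr_psd_mul_ge (sigma_min_psd (nu_gt0 hP) (posdef_psd (costR_posdef hP))) (psd_gram K^T).
rewrite -/(dot K^T K^T) -frosq froT in h3.
have e : \tr (K^T *m costR P *m K) = \tr (costR P *m (K^T^T *m K^T)).
  by rewrite trmxK -mulmxA mxtrace_mulC mulmxA.
rewrite [X in _ + X]mxtrace_mulC -mulrA -[leLHS]add0r; apply: lerD => //.
by apply: le_trans h2; rewrite ler_pM2l ?(mu_gt0 hP) // e.
Qed.

Lemma closed_loopD (K D : 'M[R]_(nu, nx)) : F (K + D) = F K - B *m D.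
Proof. by rewrite /closed_loop mulmxDr opprD addrA. Qed.

(** The defect of the cost-to-go matrix of K in the Bellman equation of the
    gain K + D; its linear part is the natural policy gradient. *)
Lemma bellman_expand (K D : 'M[R]_(nu, nx)) : (V K)^T = V K ->
  cost_mx P (K + D) + (F K - B *m D)^T *m V K *m (F K - B *m D)
    - (cost_mx P K + (F K)^T *m V K *m F K) =
  D^T *m half_grad K + (half_grad K)^T *m D + D^T *m (costR P + B^T *m V K *m B) *m D.
Proof.
move=> V_sym; rewrite /cost_mx /half_grad.
move: (V K) (F K) V_sym => W G W_sym.
have trD (p q : nat) (X Y : 'M[R]_(p, q)) : (X + Y)^T = X^T + Y^T by rewrite linearD.
have trN (p q : nat) (X : 'M[R]_(p, q)) : (- X)^T = - X^T by rewrite linearN.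
rewrite !trD !trN opprD !trmx_mul !trmxK W_sym (costR_posdef hP).1.
rewrite !(mulmxDl, mulmxDr, mulNmx, mulmxN) !mulmxA.
move: (costQ P) (K^T *m costR P *m K) (D^T *m costR P *m K) (K^T *m costR P *m D)
  (D^T *m costR P *m D) (G^T *m W *m G) (D^T *m B^T *m W *m G)
  (G^T *m W *m B *m D) (D^T *m B^T *m W *m B *m D) => a b c d e f g h k.
by apply/matrixP => p q; rewrite !mxE; ring.
Qed.

(** The performance difference identity, obtained by playing the cost-to-go
    matrix of K against the covariance of another stabilising gain K'. *)
Lemma cost_fun_diff K K' : stable K -> stable K' ->
  cost_fun K' - cost_fun K =
  \tr (((K' - K)^T *m half_grad K + (half_grad K)^T *m (K' - K)
        + (K' - K)^T *m (costR P + B^T *m V K *m B) *m (K' - K)) *m S K').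
Proof.
move=> hK hK'; rewrite (cost_fun_cov hK') /cost_fun.
have -> : Sigma0 P = S K' - F K' *m S K' *m (F K')^T.
  by rewrite {1}cov_lyap // addrK.
rewrite mulmxBr linearB /= opprB addrA.
have -> : \tr (V K *m (F K' *m S K' *m (F K')^T)) = \tr ((F K')^T *m V K *m F K' *m S K').
  by rewrite -!mulmxA [RHS]mxtrace_mulC !mulmxA.
rewrite -!linearD -!linearB /= -mulmxDl -mulmxBl; congr (\tr (_ *m _)).
rewrite {2}(value_lyap hK) -(bellman_expand _ (value_psd hK).1) -closed_loopD.
by rewrite [K + _]addrC subrK.
Qed.

End Gradient.

Lemma complete_square (R : realType) p q (s : R) (D E : 'M[R]_(p, q)) (N : 'M[R]_p) :
  s *: (D^T *m E + E^T *m D + D^T *m N *m D) =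
  s *: (D^T *m (N - s%:M) *m D) + (s *: D + E)^T *m (s *: D + E) - E^T *m E.
Proof.
have -> : (s *: D + E)^T = s *: D^T + E^T by rewrite linearD /= linearZ.
rewrite mulmxBr mulmxBl mul_mx_scalar mulmxDl !mulmxDr -!scalemxAl -!scalemxAr.
move: (D^T *m E) (E^T *m D) (D^T *m N *m D) (E^T *m E) (D^T *m D) => a b c d f.
by apply/matrixP => i j; rewrite !mxE; ring.
Qed.

Lemma conj_diff (R : realType) m n (G Z : 'M[R]_(m, n)) (W : 'M[R]_n) :
  (G - Z) *m W *m (G - Z)^T - G *m W *m G^T =
  - (Z *m W *m (G - Z)^T) - G *m W *m Z^T.
Proof.
have -> : (G - Z)^T = G^T - Z^T by rewrite linearB.
rewrite !(mulmxBl, mulmxBr).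
move: (G *m W *m G^T) (Z *m W *m G^T) (G *m W *m Z^T) (Z *m W *m Z^T) => a b c d.
by apply/matrixP => i j; rewrite !mxE; ring.
Qed.

Section Smooth.
Variables (R : realType) (M nx nu : nat) (P : fedlqr R M nx nu).
Hypothesis hP : regular P.
Variable i : 'I_M.

Local Notation F := (closed_loop P i).
Local Notation V := (value_mx P i).
Local Notation S := (cov_mx P i).
Local Notation A := (sysA P i).
Local Notation B := (sysB P i).
Local Notation cost_fun := (cost_fun P i).
Local Notation half_grad := (half_grad P i).
Local Notation grad_mx := (grad_mx P i).
Local Notation stable K := (pow_cvg0 (F K)).



(** Completing the square in the performance difference between K and the
    comparison gain. *)
Lemma gradient_dominance K Ks : stable K -> stable Ks ->
  cost_fun K - cost_fun Ks <=
  specnorm (S Ks) / (4 * mu P ^+ 2 * sigma_min (costR P)) * fro (grad_mx K) ^+ 2.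
Proof.
have arith (q x y a b z w : R) : 0 <= b -> 0 <= w - z ->
  q * (y - x) = q * a + b - z -> 0 <= q * a -> q * (x - y) <= w by lra.
have arith2 (x y q g p w : R) : w * (q * g) <= w * p -> q * (y * x) <= q * (w * g) ->
  x * (q * y) <= w * p by lra.
move=> hK hKs; have sR_gt0 := sigma_minR_gt0 hP; have mu_pos := mu_gt0 hP; set s := sigma_min (costR P); set E := half_grad K.
have pE : s * (cost_fun K - cost_fun Ks) <= specnorm (S Ks) * fro E ^+ 2.
  have e := cost_fun_diff hP hK hKs.
  pose D : 'M[R]_(nu, nx) := Ks - K; pose G : 'M[R]_(nu, nx) := s *: D + E.
  pose N : 'M[R]_nu := costR P + B^T *m V K *m B.
  have pN : psd (N - s%:M).
    rewrite /N addrAC; apply: psdD; first exact: sigma_min_psd (nu_gt0 hP) (posdef_psd (costR_posdef hP)).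
    exact/psd_conjT/(value_psd hP hK).
  have sq : s *: (D^T *m E + E^T *m D + D^T *m N *m D) =
      s *: (D^T *m (N - s%:M) *m D) + G^T *m G - E^T *m E.
    exact: complete_square.
  have pS := cov_psd hP hKs.
  have h1 := tr_psd_mul_ge0 (psd_conjT D pN) pS.
  have h2 := tr_psd_mul_ge0 (psd_gram G) pS.
  have h3 := tr_psd_mul_ge0 (specnorm_psd pS.1) (psd_gram E).
  rewrite mulmxBl mul_scalar_mx linearB /= mxtraceZ -/(dot E E) -frosq mxtrace_mulC in h3.
  have := congr1 (fun Z => \tr (Z *m S Ks)) sq; rewrite -scalemxAl mxtraceZ -e.
  rewrite mulmxBl mulmxDl -scalemxAl linearB linearD /= mxtraceZ => h4.
  exact: (arith _ _ _ _ _ _ _ h2 h3 h4 (mulr_ge0 (ltW sR_gt0) h1)).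
have pG : mu P ^+ 2 * fro E ^+ 2 <= fro (E *m S K) ^+ 2.
  have [E0|E0] := eqVneq (fro E) 0; first by rewrite E0 expr0n mulr0 sqr_ge0.
  have E_gt0 : 0 < fro E by rewrite lt_def E0 fro_ge0.
  have h := tr_psd_mul_ge (cov_ge hP hK) (psd_gram E).
  have h2 := le_trans (ler_norm _) (dot_le E (E *m S K)).
  rewrite -/(dot E E) -frosq in h.
  have h3 : \tr (S K *m (E^T *m E)) = dot E (E *m S K).
    by rewrite /dot mxtrace_mulC mulmxA.
  have h4 : mu P * fro E <= fro (E *m S K).
    by rewrite -(ler_pM2r E_gt0) -mulrA -expr2 [leRHS]mulrC (le_trans h) // h3.
  by rewrite -exprMn ler_pXn2r ?nnegrE ?mulr_ge0 ?fro_ge0 // ltW.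
have s0 : 0 < s := sR_gt0.
have m2 : 0 < mu P ^+ 2 by rewrite exprn_gt0.
have -> : fro (grad_mx K) ^+ 2 = 4 * fro (E *m S K) ^+ 2.
  by rewrite /grad_mx froZ ger0_norm // exprMn; congr (_ * _); ring.
have -> (x y : R) : x / (4 * mu P ^+ 2 * s) * (4 * y) = x * y / (mu P ^+ 2 * s).
  by field; rewrite !gt_eqF.
rewrite ler_pdivlMr ?mulr_gt0 //.
exact: arith2 (ler_wpM2l (specnorm_ge0 (S Ks)) pG) (ler_wpM2l (ltW m2) pE).
Qed.

(** The data enter the estimates below only through these three coercivity
    constants, kept abstract so that arithmetic never unfolds them. *)
Lemma coercivity : exists m q r : R, [/\ 0 < m, 0 < q & 0 < r] /\
  [/\ psd (Sigma0 P - m%:M), forall K, psd (cost_mx P K - q%:M) &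
      forall K, stable K -> [/\ m * \tr (V K) <= cost_fun K,
        q * \tr (S K) <= cost_fun K & m * r * fro K ^+ 2 <= cost_fun K]].
Proof.
exists (mu P), (sigma_min (costQ P)), (sigma_min (costR P)); split; split.
- exact: mu_gt0 hP.
- exact: sigma_minQ_gt0.
- exact: sigma_minR_gt0.
- exact: Sigma0_ge.
- exact: cost_mx_ge.
move=> K hK; split; [exact: mu_tr_value_le|exact: sigma_minQ_tr_cov_le|exact: gain_sqr_le].
Qed.

Lemma half_gradD (K D : 'M[R]_(nu, nx)) :
  half_grad (K + D) - half_grad K = costR P *m D
    - (B^T *m (V (K + D) - V K) *m F (K + D) - B^T *m V K *m (B *m D)).
Proof.
rewrite /half_grad closed_loopD.
move: (V (K + D)) (V K) (F K) => V' W G; rewrite mulmxDr !(mulmxBr, mulmxBl).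
move: (costR P *m K) (costR P *m D) (B^T *m V' *m G) (B^T *m W *m G)
  (B^T *m V' *m (B *m D)) (B^T *m W *m (B *m D)) => a0 a1 a2 a3 a4 a5.
by apply/matrixP => a b; rewrite !mxE; ring.
Qed.

(** On the sublevel set the matrices F, V and S are bounded by coercivity, so
    the perturbation bounds for the two Lyapunov equations hold uniformly, and
    everything else is a sum of products.  All bounds weaken as c grows, which
    lets several agents share one constant. *)
Lemma smooth_bounds (cbar : R) : exists2 c0, 0 < c0 & forall c, c0 <= c ->
  forall K D : 'M[R]_(nu, nx), stable K -> cost_fun K <= cbar -> fro D <= c^-1 ->
  [/\ stable (K + D), fro (grad_mx K) <= c,
      fro (grad_mx (K + D) - grad_mx K) <= c * fro D &
      `|cost_fun (K + D) - cost_fun K - dot (grad_mx K) D| <= c * fro D ^+ 2].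
Proof.
have scale_le (a k y x c e z : R) : 0 <= a -> 0 <= k -> 0 <= y <= c * z -> 0 <= x <= e ->
    a * (k * y * x) <= a * (k * c * e) * z.
  move=> a0 k0 /andP[y0 yc] /andP[x0 xe].
  have -> : a * (k * c * e) * z = a * k * (c * z * e) by ring.
  have -> : a * (k * y * x) = a * k * (y * x) by ring.
  by rewrite ler_wpM2l ?mulr_ge0 // ler_pM.
have [m [q [r0 [[m_gt0 q_gt0 r0_gt0] [S0_ge W_ge coer]]]]] := coercivity.
(* Pairs of a gain t.1 in the sublevel set and an increment t.2; orders are
   counted in powers of the norm of the increment. *)
pose T := ('M[R]_(nu, nx) * 'M[R]_(nu, nx))%type.
pose d (t : T) := fro t.2.
pose D1 := [set t : T | [/\ stable t.1, cost_fun t.1 <= cbar & fro t.2 <= 1]].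
have d_ge0 (X : set T) t : X t -> 0 <= d t by move=> _; exact: fro_ge0.
have oV : unifO D1 d 0 (fun t => V t.1).
  apply: (@unifO_psd _ _ _ _ _ _ (cbar / m)) => t [t_st t_c _].
  split; first exact: (value_psd hP t_st).
  by rewrite ler_pdivlMr // mulrC; have [h _ _] := coer _ t_st; exact: le_trans h t_c.
have oS : unifO D1 d 0 (fun t => S t.1).
  apply: (@unifO_psd _ _ _ _ _ _ (cbar / q)) => t [t_st t_c _].
  split; first exact: (cov_psd hP t_st).
  by rewrite ler_pdivlMr // mulrC; have [_ h _] := coer _ t_st; exact: le_trans h t_c.
have oK : unifO D1 d 0 (fun t => t.1).
  exists (Num.sqrt (cbar / (m * r0))) => [|t [t_st t_c _]]; first exact: sqrtr_ge0.
  rewrite mulr1 -[leLHS]ger0_norm ?fro_ge0 // -sqrtr_sqr; apply: ler_wsqrtr.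
  rewrite ler_pdivlMr ?mulr_gt0 // mulrC.
  by have [_ _ h] := coer _ t_st; exact: le_trans h t_c.
have oD : unifO D1 d 1 (fun t => t.2) by exists 1 => // t _; rewrite mul1r.
have w a b (f : T -> 'M[R]_(a, b)) : unifO D1 d 1 f -> unifO D1 d 0 f.
  by apply: unifO_weaken; [exact: d_ge0|move=> t []].
have oA a b (Z : 'M[R]_(a, b)) : unifO D1 d 0 (fun=> Z) by exact: unifO_cst.
have oF : unifO D1 d 0 (fun t => F t.1) by exact: unifOB (oA _ _ A) (unifOM (oA _ _ B) oK).
have oBD : unifO D1 d 1 (fun t => B *m t.2) by exact: unifOM (oA _ _ B) oD.
have oK' : unifO D1 d 0 (fun t => t.1 + t.2) by exact: unifOD oK (w _ _ _ oD).
have oF' : unifO D1 d 0 (fun t => F (t.1 + t.2)).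
  exact: unifOB (oA _ _ A) (unifOM (oA _ _ B) oK').
have eF (t : T) : F (t.1 + t.2) = F t.1 - B *m t.2 by exact: closed_loopD.
have oYS : unifO D1 d 1 (fun t => F (t.1 + t.2) *m S t.1 *m (F (t.1 + t.2))^T
    - F t.1 *m S t.1 *m (F t.1)^T).
  apply: (@unifO_eq _ _ _ _ _ _ _ (fun t => - (B *m t.2 *m S t.1 *m (F (t.1 + t.2))^T)
    - F t.1 *m S t.1 *m (B *m t.2)^T)).
    by move=> t _; rewrite eF conj_diff.
  apply: unifOB; first apply: unifON.
    exact: unifOM (unifOM oBD oS) (unifO_tr oF').
  exact: unifOM (unifOM oF oS) (unifO_tr oBD).
have oYV : unifO D1 d 1 (fun t => (F (t.1 + t.2))^T *m V t.1 *m F (t.1 + t.2)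
    - (F t.1)^T *m V t.1 *m F t.1).
  apply: (@unifO_eq _ _ _ _ _ _ _ (fun t => - ((B *m t.2)^T *m V t.1 *m F (t.1 + t.2))
    - (F t.1)^T *m V t.1 *m (B *m t.2))).
    move=> t _; rewrite eF; have := conj_diff (F t.1)^T (B *m t.2)^T (V t.1).
    by rewrite -linearB /= !trmxK => ->.
  apply: unifOB; first apply: unifON.
    exact: unifOM (unifOM (unifO_tr oBD) oV) oF'.
  exact: unifOM (unifOM (unifO_tr oF) oV) oBD.
(* The radius 1/r makes the perturbation of each equation at most half of its
   coercivity constant. *)
have [cS cS0 hS] := oYS; have [cV cV0 hV] := oYV.
pose r : R := 1 + 2 * cS / m + 2 * cV / q.
have r1 : 1 <= r.
  by rewrite /r -addrA lerDl addr_ge0 // divr_ge0 ?mulr_ge0 // ltW.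
pose D2 := [set t : T | [/\ stable t.1, cost_fun t.1 <= cbar & fro t.2 <= r^-1]].
have D21 : D2 `<=` D1.
  move=> t [? ? h]; split=> //; apply: le_trans h _.
  by rewrite invf_le1 // (lt_le_trans _ r1).
have small t (c p : R) : D2 t -> 0 <= c -> 0 < p -> 2 * c / p <= r -> c * d t ^+ 1 <= p / 2.
  move=> [_ _ h] c0 p0 hr; rewrite expr1.
  have r_gt0 : 0 < r by apply: lt_le_trans r1.
  apply: le_trans (ler_wpM2l c0 h) _; rewrite ler_pdivrMr //.
  move: hr; rewrite ler_pdivrMr // => hr; lra.
have rS : 2 * cS / m <= r.
  have : 0 <= 2 * cV / q by rewrite divr_ge0 ?mulr_ge0 // ltW.
  rewrite /r; lra.
have rV : 2 * cV / q <= r.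
  have : 0 <= 2 * cS / m by rewrite divr_ge0 ?mulr_ge0 // ltW.
  rewrite /r; lra.
have st' t : D2 t -> stable (t.1 + t.2).
  move=> Dt; have [t_st _ _] := Dt.
  apply: (perturb_pow_cvg0 m_gt0 (cov_psd hP t_st) S0_ge (cov_lyap t_st)).
  exact: le_trans (hS _ (D21 _ Dt)) (small _ _ _ Dt cS0 m_gt0 rS).
have oSS : unifO D2 d 1 (fun t => S (t.1 + t.2) - S t.1).
  have [cT cT0 hT] := unifO_mxtrace oS.
  exists (nx%:R * (2 / m * cS * cT)) => [|t Dt].
    by rewrite !mulr_ge0 // ?invr_ge0 ltW.
  have [t_st _ _] := Dt; have t_st' := st' t Dt.
  have hY := hS _ (D21 _ Dt).
  have h := perturb_lyap m_gt0 (cov_psd hP t_st) S0_ge (cov_lyap t_st)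
    (le_trans hY (small _ _ _ Dt cS0 m_gt0 rS)) (Sigma0_psd hP).1 (Sigma0_psd hP).1 (cov_lyap t_st').
  apply: le_trans h _; rewrite subrr fro0 add0r.
  apply: scale_le => //; first by rewrite divr_ge0 // ltW.
    by rewrite fro_ge0; exact: hY.
  rewrite psd_tr_ge0 /=; last exact: (cov_psd hP t_st).
  by have := hT _ (D21 _ Dt); rewrite mulr1; apply: le_trans; exact: ler_norm.
have oW : unifO D1 d 1 (fun t => cost_mx P (t.1 + t.2) - cost_mx P t.1).
  apply: (@unifO_eq _ _ _ _ _ _ _ (fun t => t.2^T *m costR P *m (t.1 + t.2)
    + t.1^T *m costR P *m t.2)).
    move=> t _; rewrite /cost_mx [(_ + _)^T]linearD /= !(mulmxDl, mulmxDr) opprD.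
    move: (costQ P) (t.1^T *m _ *m t.1) (t.1^T *m _ *m t.2) (t.2^T *m _ *m t.1) (t.2^T *m _ *m t.2) => a0 a1 a2 a3 a4.
    by apply/matrixP => a b; rewrite !mxE; ring.
  apply: unifOD.
    exact: unifOM (unifOM (unifO_tr oD) (oA _ _ (costR P))) oK'.
  exact: unifOM (unifOM (unifO_tr oK) (oA _ _ (costR P))) oD.
have cost_mx_sym K : (cost_mx P K)^T = cost_mx P K by exact: (cost_mx_psd hP K).1.
have oVV : unifO D2 d 1 (fun t => V (t.1 + t.2) - V t.1).
  have [cT cT0 hT] := unifO_mxtrace oV; have [cX cX0 hX] := oW.
  exists (nx%:R * (2 / q * (cX + cV) * cT)) => [|t Dt].
    by rewrite !mulr_ge0 // ?invr_ge0 ?addr_ge0 // ltW.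
  have [t_st _ _] := Dt; have t_st' := st' t Dt.
  have hY := hV _ (D21 _ Dt).
  have lV K : stable K -> V K = cost_mx P K + (F K)^T *m V K *m (F K)^T^T.
    by move=> hK; rewrite trmxK; exact: value_lyap.
  have h := @perturb_lyap _ _ _ (F (t.1 + t.2))^T _ _ _ q_gt0 (value_psd hP t_st)
    (W_ge _) (lV _ t_st).
  rewrite !trmxK in h.
  have {}h := h (le_trans hY (small _ _ _ Dt cV0 q_gt0 rV)) _ _ (cost_mx_sym _) (cost_mx_sym _).
  have {}h := h _ _ (value_lyap t_st').
  apply: le_trans h _; apply: scale_le => //; first by rewrite divr_ge0 // ltW.
    by rewrite addr_ge0 ?fro_ge0 //= mulrDl; apply: lerD; [exact: hX (D21 _ Dt)|exact: hY].
  rewrite psd_tr_ge0 /=; last exact: (value_psd hP t_st).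
  by have := hT _ (D21 _ Dt); rewrite mulr1; apply: le_trans; exact: ler_norm.
have u k a b (f : T -> 'M[R]_(a, b)) : unifO D1 d k f -> unifO D2 d k f.
  exact: unifO_sub.
have oE : unifO D1 d 0 (fun t => half_grad t.1).
  exact: unifOB (unifOM (oA _ _ (costR P)) oK) (unifOM (unifOM (oA _ _ B^T) oV) oF).
have oEE : unifO D2 d 1 (fun t => half_grad (t.1 + t.2) - half_grad t.1).
  apply: (@unifO_eq _ _ _ _ _ _ _ (fun t => costR P *m t.2
    - (B^T *m (V (t.1 + t.2) - V t.1) *m F (t.1 + t.2) - B^T *m V t.1 *m (B *m t.2)))).
    by move=> t _; rewrite half_gradD.
  apply: unifOB (u _ _ _ _ (unifOM (oA _ _ (costR P)) oD)) _; apply: unifOB.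
    exact: unifOM (unifOM (u _ _ _ _ (oA _ _ B^T)) oVV) (u _ _ _ _ oF').
  exact: u _ _ _ _ (unifOM (unifOM (oA _ _ B^T) oV) oBD).
have w2 a b (f : T -> 'M[R]_(a, b)) : unifO D2 d 1 f -> unifO D2 d 0 f.
  by apply: unifO_weaken; [exact: d_ge0|move=> t /D21[]].
have oS' : unifO D2 d 0 (fun t => S (t.1 + t.2)).
  apply: (@unifO_eq _ _ _ _ _ _ _ (fun t => S t.1 + (S (t.1 + t.2) - S t.1))).
    by move=> t _; rewrite addrC subrK.
  exact: unifOD (u _ _ _ _ oS) (w2 _ _ _ oSS).
have [c1 c1_ge0 hc1] : unifO D2 d 0 (fun t => grad_mx t.1).
  exact: u _ _ _ _ (unifOZ 2 (unifOM oE oS)).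
have [c2 c2_ge0 hc2] : unifO D2 d 1 (fun t => grad_mx (t.1 + t.2) - grad_mx t.1).
  apply: (@unifO_eq _ _ _ _ _ _ _ (fun t => 2 *: ((half_grad (t.1 + t.2) - half_grad t.1)
    *m S (t.1 + t.2) + half_grad t.1 *m (S (t.1 + t.2) - S t.1)))).
    by move=> t _; rewrite mulmxBl mulmxBr addrA subrK scalerBr.
  apply/unifOZ/unifOD; first exact: unifOM oEE oS'.
  exact: unifOM (u _ _ _ _ oE) oSS.
(* The remainder of the cost: the performance difference minus the pairing
   with the gradient, after merging the two transposed linear terms. *)
pose N (t : T) : 'M[R]_nu := costR P + B^T *m V t.1 *m B.
have oN : unifO D1 d 0 N.
  exact: unifOD (oA _ _ (costR P)) (unifOM (unifOM (oA _ _ B^T) oV) (oA _ _ B)).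
pose rem (t : T) : 'M[R]_nx := 2 *: ((half_grad t.1)^T *m t.2 *m (S (t.1 + t.2) - S t.1))
    + t.2^T *m N t *m t.2 *m S (t.1 + t.2).
have orem : unifO D2 d 2 rem.
  apply: unifOD; first apply/unifOZ.
    exact: unifOM (unifOM (unifO_tr (u _ _ _ _ oE)) (u _ _ _ _ oD)) oSS.
  exact: unifOM (u _ _ _ _ (unifOM (unifOM (unifO_tr oD) oN) oD)) oS'.
have [c3 c3_ge0 hc3] := unifO_mxtrace orem.
exists (r + c1 + c2 + c3); first by lra.
move=> c hc K D hK hKc hD.
have Dt : D2 (K, D).
  split=> //=; apply: le_trans hD _; rewrite lef_pV2 ?posrE; lra.
have hK' := st' _ Dt; split=> //.
- have := hc1 _ Dt; rewrite mulr1; lra.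
- apply: le_trans (hc2 _ Dt) _; rewrite expr1 ler_wpM2r ?fro_ge0 //; lra.
apply: (@le_trans _ _ (c3 * fro D ^+ 2)); last first.
  by rewrite ler_wpM2r ?sqr_ge0 //; lra.
suff -> : cost_fun (K + D) - cost_fun K - dot (grad_mx K) D = \tr (rem (K, D)) by exact: hc3 _ Dt.
rewrite (cost_fun_diff hP hK hK') /=.
have -> : K + D - K = D by rewrite addrC addKr.
have -> : dot (grad_mx K) D = 2 * \tr ((half_grad K)^T *m D *m S K).
  rewrite dotZl /dot trmx_mul (cov_psd hP hK).1; congr (2 * _).
  by rewrite -[RHS]mxtrace_mulC mulmxA.
have S'_sym := (cov_psd hP hK').1; rewrite /rem /= -/(N (K, D)).
move: (half_grad K) (S (K + D)) (S K) (N (K, D)) S'_sym => E S' SK W S'_sym.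
rewrite mulmxBr !mulmxDl !mxtraceD mxtraceZ linearB /=.
have -> : \tr (D^T *m E *m S') = \tr (E^T *m D *m S').
  by rewrite -mxtrace_tr !trmx_mul trmxK S'_sym mxtrace_mulC.
ring.
Qed.

End Smooth.

(** * Gradient descent on the costs *)

Section Descent.
Variables (R : realType) (M nx nu : nat) (P : fedlqr R M nx nu).
Hypothesis hP : regular P.

(** The conclusion of [smooth_bounds] at one gain. *)
Definition smooth_at (c : R) (i : 'I_M) (K : 'M[R]_(nu, nx)) : Prop :=
  forall D : 'M[R]_(nu, nx), fro D <= c^-1 ->
  [/\ pow_cvg0 (closed_loop P i (K + D)), fro (grad_mx P i K) <= c,
      fro (grad_mx P i (K + D) - grad_mx P i K) <= c * fro D &
      `|cost_fun P i (K + D) - cost_fun P i K - dot (grad_mx P i K) D| <= c * fro D ^+ 2].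

(** The quadratic remainder bound makes the cost differentiable. *)
Lemma grad_costE i K : pow_cvg0 (closed_loop P i K) -> grad_cost P i K = grad_mx P i K.
Proof.
have quotE (g h d : R) : h != 0 -> g - h^-1 * d = - (h^-1 * (d - h * g)).
  by move=> h0; rewrite mulrBr mulKf // opprB.
move=> hK; have [c c_gt0 /(_ c (lexx c)) hc] := smooth_bounds hP i (cost_fun P i K).
apply/matrixP => a b; rewrite mxE /derive.
apply/cvg_lim => //; apply/cvgrPdist_le => e e0.
have ec : 0 < Num.min c^-1 (e / c) by rewrite lt_min invr_gt0 c_gt0 divr_gt0.
(* Both bounds on |h| matter: the first keeps the gain in the ball where the
   remainder bound holds, the second makes the remainder at most e |h|. *)
near=> h.
have h0 : h != 0 by near: h; exact: nbhs_dnbhs_neq.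
have : `|h| <= Num.min c^-1 (e / c) by near: h; exact: dnbhs0_le.
rewrite le_min => /andP[hc1]; rewrite ler_pdivlMr // => hc2.
have fhD : fro (h *: delta_mx a b : 'M[R]_(nu, nx)) = `|h| by rewrite froZ fro_delta mulr1.
have [|st _ _ rem] := hc K (h *: delta_mx a b) hK (lexx _); first by rewrite fhD.
rewrite /= [h *: _ + K]addrC !(cost_funE hP) //= -[_ *: _]/(_ * _).
move: rem; rewrite fhD dotZr dot_delta; set x := cost_fun _ _ _; set y := cost_fun _ _ _.
set g := grad_mx _ _ _ _ _ => rem.
rewrite quotE //.
rewrite normrN normrM normfV ler_pdivrMl ?normr_gt0 //; apply: le_trans rem _.
by rewrite expr2 mulrCA ler_wpM2l // mulrC.
Unshelve. all: by end_near. Qed.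

Lemma fro_avg (a : nat) (x : 'I_a -> 'M[R]_(nu, nx)) (y : 'M[R]_(nu, nx)) (b : R) :
  (0 < a)%N -> (forall t, fro (x t - y) <= b) ->
  fro (a%:R^-1 *: \sum_t x t - y) <= b.
Proof.
move=> a0 h; have a_gt0 : 0 < a%:R :> R by rewrite ltr0n.
have -> : a%:R^-1 *: \sum_t x t - y = a%:R^-1 *: \sum_t (x t - y).
  rewrite sumrB sumr_const card_ord scalerBr -(scaler_nat a y) scalerA.
  by rewrite mulVf ?scale1r // gt_eqF.
rewrite froZ ger0_norm ?invr_ge0 ?(ltW a_gt0) // ler_pdivrMl //.
apply: le_trans (fro_sum _ _) _; apply: le_trans (ler_sum _ (fun t _ => h t)) _.
by rewrite sumr_const card_ord mulr_natl.
Qed.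

Section LocalSteps.
Variables (c tau eta_l : R) (L : nat) (i : 'I_M) (K : 'M[R]_(nu, nx)).
Hypotheses (c_gt0 : 0 < c) (tau_le : tau <= c) (eta_ge0 : 0 <= eta_l).
Hypothesis eta_c : L%:R * eta_l * (2 * c ^+ 2) <= 1.
Hypothesis eta_tau : L%:R * eta_l * (2 * c ^+ 2) <= tau.
Hypothesis K_smooth : smooth_at c i K.
Local Notation K_ l := (local_iter P eta_l i K l).

(** All local iterates stay in the ball where the bounds at K apply, because
    the gradient there is at most 2 c. *)
Lemma local_drift l : (l <= L)%N ->
  fro (K_ l - K) <= l%:R * eta_l * (2 * c) /\
  (pow_cvg0 (closed_loop P i (K_ l)) /\
   fro (grad_cost P i (K_ l) - grad_mx P i K) <= tau).
Proof.
have near_K l' : (l' <= L)%N -> fro (K_ l' - K) <= l'%:R * eta_l * (2 * c) ->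
    pow_cvg0 (closed_loop P i (K_ l')) /\
    fro (grad_cost P i (K_ l') - grad_mx P i K) <= tau.
  move=> lL hD.
  have hD' : fro (K_ l' - K) <= L%:R * eta_l * (2 * c).
    by apply: le_trans hD _; rewrite !ler_wpM2r ?mulr_ge0 ?ler_nat // ltW.
  have hc : fro (K_ l' - K) <= c^-1.
    apply: le_trans hD' _; rewrite -[leRHS]mulr1 ler_pdivlMl //.
    apply: le_trans eta_c; rewrite le_eqVlt; apply/orP; left; apply/eqP; ring.
  have := K_smooth hc; rewrite [K + _]addrC subrK => -[st _ lip _].
  split=> //; rewrite grad_costE //; apply: le_trans lip _.
  apply: le_trans eta_tau; apply: le_trans (ler_wpM2l (ltW c_gt0) hD') _.
  by rewrite le_eqVlt; apply/orP; left; apply/eqP; ring.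
elim: l => [|l IH] lL.
  have h : fro (K_ 0 - K) <= 0%:R * eta_l * (2 * c) by rewrite subrr fro0 !mul0r.
  exact: (conj h (near_K _ lL h)).
have [hD [st hg]] := IH (ltnW lL).
have h : fro (K_ l.+1 - K) <= l.+1%:R * eta_l * (2 * c).
  have -> : K_ l.+1 - K = (K_ l - K) - eta_l *: grad_cost P i (K_ l) by rewrite /= addrAC.
  apply: le_trans (froB _ _) _; rewrite -natr1 mulrDl mulrDl; apply: lerD => //.
  rewrite froZ ger0_norm // mul1r ler_wpM2l //.
  have f0 : fro (0 : 'M[R]_(nu, nx)) <= c^-1 by rewrite fro0 invr_ge0 ltW.
  have [_ hK _ _] := K_smooth f0.
  rewrite -[grad_cost _ _ _](subrK (grad_mx P i K)); apply: le_trans (froD _ _) _.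
  rewrite mulr_natl mulr2n; apply: lerD; last exact: hK.
  exact: le_trans hg tau_le.
exact: (conj h (near_K _ lL h)).
Qed.

End LocalSteps.

Lemma local_iter_sum eta_l i K L :
  local_iter P eta_l i K L - K =
  - (eta_l *: \sum_(l < L) grad_cost P i (local_iter P eta_l i K l)).
Proof.
elim: L => [|L IH]; first by rewrite big_ord0 scaler0 oppr0 subrr.
by rewrite big_ord_recr /= addrAC IH scalerDr opprD.
Qed.

Lemma sqr_five_quarters (o : R) : (o + o / 4) ^+ 2 <= 2 * o ^+ 2.
Proof. by have := sqr_ge0 o; lra. Qed.

(** Polarisation: -2 <G, g> = |g - G|^2 - |g|^2 - |G|^2.  The term - x/2 |g|^2 it
    produces absorbs the second order remainder, since c x <= 1/2. *)
Lemma descent_arith (c x o C C' d p q e : R) : 1 <= c -> 0 <= x ->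
  x * (2 * c ^+ 2) <= 1 -> 0 <= p -> e = p - d *+ 2 + q -> e <= 2 * o ^+ 2 ->
  C' - C - - (x * d) <= c * (x ^+ 2 * p) -> C' <= C - x / 2 * q + x * o ^+ 2.
Proof.
move=> c1 x0 xc p0 -> he hC.
have xc2 : 0 <= x * (c ^+ 2 - c).
  by rewrite mulr_ge0 // subr_ge0 expr2 ler_peMl // (le_trans ler01).
have h1 : 0 <= x * (2 * o ^+ 2 - (p - d *+ 2 + q)) by rewrite mulr_ge0 // subr_ge0.
have h2 : 0 <= x * (1 - 2 * (x * c)) * p by rewrite !mulr_ge0 //; lra.
lra.
Qed.

(** One step of size x along a direction g that differs from the gradient by
    at most 5 omega / 4; the square of that error is at most 2 omega^2. *)
Lemma descent_step c omega x i K g : 1 <= c -> 0 <= omega -> 0 <= x ->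
  omega + omega / 4 <= c -> x * (2 * c ^+ 2) <= 1 -> smooth_at c i K ->
  fro (g - grad_mx P i K) <= omega + omega / 4 ->
  pow_cvg0 (closed_loop P i (K - x *: g)) /\
  cost_fun P i (K - x *: g) <=
    cost_fun P i K - x / 2 * fro (grad_mx P i K) ^+ 2 + x * omega ^+ 2.
Proof.
move=> c1 o0 x0 oc xc hK hg; set G := grad_mx P i K in hg *.
have c_gt0 : 0 < c by apply: lt_le_trans c1.
have f0 : fro (0 : 'M[R]_(nu, nx)) <= c^-1 by rewrite fro0 invr_ge0 ltW.
have [_ hG _ _] := hK _ f0; rewrite -/G in hG.
have hgc : fro g <= 2 * c.
  rewrite -[g](subrK G); apply: le_trans (froD _ _) _.
  rewrite mulr_natl mulr2n; apply: lerD; last exact: hG.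
  exact: le_trans hg oc.
have hD : fro (- (x *: g)) <= c^-1.
  rewrite froN froZ ger0_norm // -[leRHS]mulr1 ler_pdivlMl //.
  apply: le_trans xc; rewrite mulrCA [leRHS]mulrC [leRHS]mulrC.
  rewrite ler_wpM2l // expr2 mulrCA ler_wpM2l // ltW //.
have [st _ _ rem] := hK _ hD; split=> //.
have {}rem := le_trans (ler_norm _) rem.
rewrite froN froZ ger0_norm // dotNr dotZr -/G in rem.
have eg : fro (g - G) ^+ 2 = fro g ^+ 2 - dot G g *+ 2 + fro G ^+ 2.
  by rewrite !frosq !(dotDl, dotDr, dotNl, dotNr) (dotC g G); ring.
have hg2 : fro (g - G) ^+ 2 <= 2 * omega ^+ 2.
  apply: (@le_trans _ _ ((omega + omega / 4) ^+ 2)).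
    by rewrite ler_pXn2r ?nnegrE ?fro_ge0 // addr_ge0 // divr_ge0.
  exact: sqr_five_quarters.
apply: (descent_arith c1 x0 xc (sqr_ge0 (fro g)) eg hg2).
by move: rem; rewrite exprMn.
Qed.

End Descent.

(** * Averaged rounds *)

Section Round.
Variables (R : realType) (M nx nu : nat) (P : fedlqr R M nx nu).
Hypothesis hP : regular P.

(** A round is a single step along the average of all the local gradients,
    which differ from the gradient of any one agent by the heterogeneity omega
    and the local drift omega / 4. *)
Lemma fed_round c omega eta_l L K : (0 < M)%N -> (0 < L)%N ->
  1 <= c -> 0 <= omega -> 0 <= eta_l -> omega + omega / 4 <= c ->
  L%:R * eta_l * (2 * c ^+ 2) <= 1 -> L%:R * eta_l * (2 * c ^+ 2) <= omega / 4 ->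
  (forall i, smooth_at P c i K) ->
  (forall i j, fro (grad_mx P i K - grad_mx P j K) <= omega) ->
  let K' := K + (1 / M%:R) *: \sum_(i < M) (local_iter P eta_l i K L - K) in
  forall i, pow_cvg0 (closed_loop P i K') /\
    cost_fun P i K' <= cost_fun P i K
      - L%:R * eta_l / 2 * fro (grad_mx P i K) ^+ 2 + L%:R * eta_l * omega ^+ 2.
Proof.
have detour (x y z : 'M[R]_(nu, nx)) : x - z = (y - z) + (x - y).
  by rewrite [RHS]addrC addrA subrK.
move=> M0 L0 c1 o0 e0 oc xc xo hK hhet K' i.
have c_gt0 : 0 < c by apply: lt_le_trans c1.
have tau_c : omega / 4 <= c by apply: le_trans oc; rewrite lerDr.
pose gl j (l : 'I_L) := grad_cost P j (local_iter P eta_l j K l).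
pose g := M%:R^-1 *: \sum_j L%:R^-1 *: \sum_l gl j l.
have -> : K' = K - (L%:R * eta_l) *: g.
  have e j : local_iter P eta_l j K L - K = - eta_l *: \sum_l gl j l.
    by rewrite local_iter_sum scaleNr.
  rewrite /K' (eq_bigr _ (fun j _ => e j)) -scaler_sumr /g -scaler_sumr !scalerA -scaleNr.
  by congr (_ + _ *: _); field; rewrite !pnatr_eq0 -!lt0n M0 L0.
apply: (descent_step c1 o0 _ oc xc (hK i)); first by rewrite mulr_ge0.
apply: fro_avg => // j; apply: fro_avg => // l.
have [_ [_ h]] := local_drift hP c_gt0 tau_c e0 xc xo (hK j) (ltnW (ltn_ord l)).
rewrite (detour _ (grad_mx P j K)).
exact: le_trans (froD _ _) (lerD (hhet j i) h).
Qed.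

End Round.

Lemma affine_recurrence (R : realType) (u : nat -> R) (q b : R) N : 0 <= q -> 0 <= b ->
  (forall n, u n.+1 <= q * u n + (1 - q) * b) -> u N <= q ^+ N * u 0%N + b.
Proof.
move=> q0 b0 h; elim: N => [|N IH]; first by rewrite expr0 mul1r lerDl.
apply: le_trans (h N) _; apply: le_trans (lerD (ler_wpM2l q0 IH) (lexx _)) _.
by rewrite exprS le_eqVlt; apply/orP; left; apply/eqP; ring.
Qed.

Lemma le_sum_term (R : realType) (I : finType) (f : I -> R) i :
  (forall j, 0 <= f j) -> f i <= \sum_j f j.
Proof. by move=> f0; rewrite (bigD1 i) //= lerDl sumr_ge0. Qed.

(** * Convergence *)

Lemma eq_le_eq (R : realType) (x x' y y' : \bar R) :
  x = x' -> y = y' -> (x' <= y')%E -> (x <= y)%E.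
Proof. by move=> -> ->. Qed.

Lemma dominance_arith (R : realType) (m s p x g : R) : 0 < m -> 0 < s -> 0 < p ->
  x <= p / (4 * m * s) * g -> 4 * (m * s / p) * x <= g.
Proof.
move=> m0 s0 p0 h; have k0 : 0 <= 4 * (m * s / p) by rewrite !mulr_ge0 ?invr_ge0 // ltW.
apply: le_trans (ler_wpM2l k0 h) _; rewrite le_eqVlt; apply/orP; left; apply/eqP.
by field; rewrite !gt_eqF.
Qed.

(** The heterogeneity threshold, read for one agent. *)
Lemma threshold_arith (R : realType) (m s p u x e2 : R) : 0 < m -> 0 < s -> 0 < p ->
  0 < u -> 0 <= x -> e2 <= m * s * x / (4 * p * u) -> u * e2 <= m * s / p * x.
Proof.
move=> m0 s0 p0 u0 x0 h; apply: le_trans (ler_wpM2l (ltW u0) h) _.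
have -> : u * (m * s * x / (4 * p * u)) = 4^-1 * (m * s / p * x).
  by field; rewrite !gt_eqF.
have : 0 <= m * s / p * x by rewrite !mulr_ge0 ?invr_ge0 // ltW.
lra.
Qed.

(** Dominance gives the rate 1 - 2 x a, which a nonnegative gap relaxes to
    1 - x a. *)
Lemma round_arith (R : realType) (x a g g' w G2 : R) : 0 <= x -> 0 <= a -> 0 <= g ->
  4 * a * g <= G2 -> g' <= g - x / 2 * G2 + x * w -> g' <= (1 - x * a) * g + x * w.
Proof.
move=> x0 a0 g0 hG hg'; have := ler_wpM2l x0 hG.
have : 0 <= x * a * g by rewrite !mulr_ge0.
lra.
Qed.

Lemma invariance_arith (R : realType) (x a g g' g0 w : R) : 0 <= x -> x * a <= 1 ->
  g' <= (1 - x * a) * g + x * w -> g <= g0 -> w <= a * g0 -> g' <= g0.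
Proof.
move=> x0 xa hg' hg hw; have := ler_wpM2l x0 hw.
have : 0 <= (1 - x * a) * (g0 - g) by rewrite mulr_ge0 // subr_ge0.
lra.
Qed.

Theorem theorem3 (R : realType) :
  exists c_uni : R, 0 < c_uni /\
  forall (M nx nu : nat) (P : fedlqr R M nx nu) (H eps1 eps2 beta : R)
    (K0 : 'M[R]_(nu, nx)) (Kstar : 'I_M -> 'M[R]_(nu, nx))
    (h1 h2 : lqr_params R -> R) (L : nat),
  (0 < M)%N -> (0 < nx)%N -> (0 < nu)%N ->
  (forall i, stabilizable P i) ->
  (forall a : 'I_nx, ('E_(init P)[fun x0 => tnth x0 a] = 0)%E) ->
  0 < mu P ->
  {ae init P, forall x0, l2norm (col_of_tuple x0) <= H} ->
  posdef (costQ P) -> posdef (costR P) ->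
  (forall i, is_minimizer P i (Kstar i)) ->
  0 < eps1 -> 0 < eps2 ->
  (forall i j, specnorm (sysA P i - sysA P j) <= eps1) ->
  (forall i j, specnorm (sysB P i - sysB P j) <= eps2) ->
  (forall i, stabilizes P i K0) ->
  1 <= beta ->
  (forall K, (forall i, stabilizes P i K) ->
     0 < h1 (params P K) /\ 0 < h2 (params P K)) ->
  has_ubound [set h1 (params P K) | K in stab_set P Kstar K0 beta] ->
  has_ubound [set h2 (params P K) | K in stab_set P Kstar K0 beta] ->
  (forall K, (forall i, stabilizes P i K) ->
     forall i j, specnorm (grad_cost P i K - grad_cost P j K)
       <= eps1 * h1 (params P K) + eps2 * h2 (params P K)) ->
  (0 < L)%N ->
  let G0 := stab_set P Kstar K0 beta in
  let e := eps1 * hbar P G0 h1 + eps2 * hbar P G0 h2 in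
  e ^+ 2 <= hbar3 P Kstar K0 ->
  exists eta_g eta_l : R, 0 < eta_g /\ 0 < eta_l /\
    let eta := L%:R * eta_g * eta_l in
    let K_ := fed_iter P L eta_g eta_l K0 in
    (* the gradients used by the iteration exist *)
    (forall n i l, (l < L)%N ->
       stabilizes P i (local_iter P eta_l i (K_ n) l)) /\
    forall N : nat,
      (forall i : 'I_M,
        (cost P i (K_ N) - cost P i (Kstar i)
         <= ((1 - eta * mu P ^+ 2 * sigma_min (costR P)
                  / specnorm (SigmaK P i (Kstar i))) ^+ N)%:E
              * (cost P i K0 - cost P i (Kstar i))
            + (c_uni * het_bound P Kstar i e)%:E)%E) /\
      (forall n : nat, (n <= N)%N -> G0 (K_ n)).
Proof.
exists 4; split=> // M nx nu P H eps1 eps2 beta K0 Kstar h1 h2 L M_gt0 nx_gt0 nu_gt0.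
move=> _ _ mu_gt0 init_bd Q_pos R_pos Kstar_min eps1_gt0 eps2_gt0 _ _ K0_stab beta1.
move=> h_pos h1_ub h2_ub het L_gt0 G0 e he.
have hP : regular P by split=> //; exists H.
have stabE i K : stabilizes P i K <-> pow_cvg0 (closed_loop P i K).
  exact: spectral_radius_pow_cvg0.
have {}K0_stab i : pow_cvg0 (closed_loop P i K0) by apply/stabE.
have Ks_stab i : pow_cvg0 (closed_loop P i (Kstar i)).
  apply: (cost_le_stable hP (c := cost_fun P i K0)).
  by rewrite -(cost_funE hP (K0_stab i)); exact: Kstar_min.
(* All costs involved are finite, so the argument runs on the real numbers
   gap. *)
pose gap i K := cost_fun P i K - cost_fun P i (Kstar i).
have gapE i K : pow_cvg0 (closed_loop P i K) ->
    (cost P i K - cost P i (Kstar i))%E = (gap i K)%:E.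
  by move=> hK; rewrite (cost_funE hP hK) (cost_funE hP (Ks_stab i)).
have gap_ge0 i K : pow_cvg0 (closed_loop P i K) -> 0 <= gap i K.
  by move=> hK; have := Kstar_min i K; rewrite (cost_funE hP hK) (cost_funE hP (Ks_stab i)) lee_fin subr_ge0.
pose good K := forall i, pow_cvg0 (closed_loop P i K) /\ cost_fun P i K <= cost_fun P i K0.
have goodK0 : good K0 by move=> i; split.
have good_G0 K : good K -> G0 K.
  move=> hK i; have [st hc] := hK i; have := gap_ge0 i _ (K0_stab i).
  move=> g0; apply: (eq_le_eq (gapE _ _ st) (congr1 (mule beta%:E) (gapE _ _ (K0_stab i)))).
  rewrite -EFinM lee_fin /gap; move: g0; rewrite /gap => g0.
  apply: (@le_trans _ _ (cost_fun P i K0 - cost_fun P i (Kstar i))).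
    by rewrite lerD2r.
  by rewrite ler_peMl.
have hbar_ge (h : lqr_params R -> R) K :
    has_ubound [set h (params P K) | K in G0] -> good K -> h (params P K) <= hbar P G0 h.
  move=> hub hK; apply: sup_upper_bound; last by exists K => //; exact: good_G0.
  by split=> //; exists (h (params P K)), K => //; exact: good_G0.
(* A positive heterogeneity bound leaves room for the drift of the local
   steps. *)
have e_gt0 : 0 < e.
  have [|a b] := h_pos K0; first by move=> i; apply/stabE.
  have := hbar_ge _ _ h1_ub goodK0; have := hbar_ge _ _ h2_ub goodK0 => hb ha.
  by rewrite addr_gt0 // mulr_gt0 // (lt_le_trans _ ha, lt_le_trans _ hb).
pose ups : R := (minn nx nu)%:R.
have ups_gt0 : 0 < ups by rewrite ltr0n leq_min nx_gt0.
pose omega := Num.sqrt ups * e.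
have omega_gt0 : 0 < omega by rewrite mulr_gt0 // sqrtr_gt0.
have omega2 : omega ^+ 2 = ups * e ^+ 2 by rewrite exprMn sqr_sqrtr // ltW.
have grad_het K i j : good K -> fro (grad_mx P i K - grad_mx P j K) <= omega.
  move=> hK; apply: fro_le; first exact: ltW.
  rewrite omega2; apply: le_trans (dot_le_specnorm _) _; rewrite minnC.
  rewrite ler_wpM2l ?(ltW ups_gt0) // ler_pXn2r ?nnegrE ?specnorm_ge0 ?(ltW e_gt0) //.
  have hKs k : stabilizes P k K by apply/stabE; case: (hK k).
  rewrite -!(grad_costE hP); [|by case: (hK j)|by case: (hK i)].
  apply: le_trans (het _ hKs i j) _; apply: lerD.
    by rewrite ler_pM2l // hbar_ge.
  by rewrite ler_pM2l // hbar_ge.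
pose spec i := specnorm (SigmaK P i (Kstar i)).
have spec_gt0 i : 0 < spec i.
  rewrite /spec (SigmaK_stable hP (Ks_stab i)).
  have S_psd := cov_psd hP (Ks_stab i); pose v : 'cV[R]_nx := delta_mx (Ordinal nx_gt0) 0.
  have mu_le := psd_ge v (cov_ge hP (Ks_stab i)).
  have := (specnorm_psd S_psd.1).2 v; rewrite quadB quad_scalar subr_ge0.
  have -> : dot v v = 1 by rewrite -frosq fro_delta expr1n.
  rewrite -frosq fro_delta expr1n !mulr1 in mu_le *.
  by move=> /(le_trans mu_le); apply: lt_le_trans.
pose sR := sigma_min (costR P).
have sR_gt0 : 0 < sR := sigma_minR_gt0 hP.
pose a i := mu P ^+ 2 * sR / spec i.
have a_gt0 i : 0 < a i by rewrite divr_gt0 // mulr_gt0 // exprn_gt0.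
have dom i K : pow_cvg0 (closed_loop P i K) -> 4 * a i * gap i K <= fro (grad_mx P i K) ^+ 2.
  move=> hK; have := gradient_dominance hP hK (Ks_stab i).
  rewrite -(SigmaK_stable hP (Ks_stab i)) -/(spec i) -/sR -/(gap i K).
  by apply: dominance_arith => //; exact: exprn_gt0.
have omega_gap i : omega ^+ 2 <= a i * gap i K0.
  rewrite omega2; apply: threshold_arith => //; first exact: exprn_gt0.
    exact: gap_ge0.
  apply: le_trans he _; apply: ge_inf.
    exists 0 => _ [j _ <-]; rewrite (gapE _ _ (K0_stab j)) /=; apply: divr_ge0.
      apply: mulr_ge0; last exact: gap_ge0.
      by apply: mulr_ge0; [exact: sqr_ge0|exact: ltW].
    by rewrite !mulr_ge0 ?specnorm_ge0.
  by exists i => //; rewrite (gapE _ _ (K0_stab i)).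
have /choice[c0 hc0] : forall i, exists c0 : R, 0 < c0 /\
    forall c, c0 <= c -> forall K, good K -> smooth_at P c i K.
  move=> i; have [c0 c0_gt0 h] := smooth_bounds hP i (cost_fun P i K0).
  exists c0; split=> // c hc K hK D; have [st hcost] := hK i; exact: h.
(* Each summand of c serves one of the four lower bounds on c below. *)
pose c := 1 + (omega + omega / 4) + \sum_i c0 i + \sum_i a i.
have c0_ge0 : 0 <= \sum_i c0 i by apply: sumr_ge0 => i _; exact: ltW (hc0 i).1.
have a_ge0 : 0 <= \sum_i a i by apply: sumr_ge0 => i _; exact: ltW.
have c1 : 1 <= c by rewrite /c; lra.
have omega_c : omega + omega / 4 <= c by rewrite /c; lra.
have c0_c i : c0 i <= c.
  have := le_sum_term i (fun j => ltW (hc0 j).1); rewrite /c; lra.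
have a_c i : a i <= c.
  have := le_sum_term i (fun j => ltW (a_gt0 j)); rewrite /c; lra.
have c2_gt0 : 0 < 2 * c ^+ 2 by rewrite mulr_gt0 // exprn_gt0 // (lt_le_trans _ c1).
(* The global step is eta_g = 1, so x is the effective step eta.  The bound 1
   keeps the iterates in the ball of radius 1/c, the bound omega / 4 limits
   the local drift. *)
pose x := Num.min 1 (omega / 4) / (2 * c ^+ 2).
have x_gt0 : 0 < x by rewrite divr_gt0 // lt_min ltr01 divr_gt0.
have xc : x * (2 * c ^+ 2) = Num.min 1 (omega / 4) by rewrite divfK // gt_eqF.
have xc1 : x * (2 * c ^+ 2) <= 1 by rewrite xc ge_min lexx.
have xc2 : x * (2 * c ^+ 2) <= omega / 4 by rewrite xc ge_min lexx orbT.
have xa i : x * a i <= 1.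
  apply: le_trans xc1; rewrite ler_pM2l //; apply: le_trans (a_c i) _.
  move: c1; clear; nra.
have L_neq0 : L%:R != 0 :> R by rewrite pnatr_eq0 -lt0n.
pose eta_l := x / L%:R; have Leta : L%:R * eta_l = x by rewrite mulrC divfK.
have eta_l_gt0 : 0 < eta_l by rewrite divr_gt0 // ltr0n.
pose K_ := fed_iter P L 1 eta_l K0.
have smooth K i : good K -> smooth_at P c i K by move=> hK; exact: (hc0 i).2.
have step n : good (K_ n) -> forall i, pow_cvg0 (closed_loop P i (K_ n.+1)) /\
    gap i (K_ n.+1) <= (1 - x * a i) * gap i (K_ n) + x * omega ^+ 2.
  move=> hK i.
  have := @fed_round _ _ _ _ _ hP c omega eta_l L (K_ n) M_gt0 L_gt0 c1 (ltW omega_gt0)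
    (ltW eta_l_gt0) omega_c.
  rewrite Leta => /(_ xc1 xc2 (fun j => smooth _ j hK) (fun j k => grad_het _ j k hK) i).
  move=> [st hcost]; split; first exact: st.
  apply: (round_arith (ltW x_gt0) (ltW (a_gt0 i)) (gap_ge0 i _ (hK i).1) (dom i _ (hK i).1)).
  by rewrite /gap; move: hcost; rewrite -/(K_ n.+1); lra.
(* The sublevel sets are invariant because omega^2 is at most a times the
   initial gap. *)
have goodK n : good (K_ n).
  elim: n => [|n IH] // i; have [st hgap] := step n IH i; split=> //.
  rewrite -(lerD2r (- cost_fun P i (Kstar i))).
  apply: (invariance_arith (ltW x_gt0) (xa i) hgap _ (omega_gap i)).
  by rewrite /gap lerD2r; exact: (IH i).2.
exists 1, eta_l; split=> //; split=> //= ; split.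
  move=> n i l lL; apply/stabE.
  have omega4_c : omega / 4 <= c by apply: le_trans omega_c; rewrite lerDr ltW.
  have h := @local_drift _ _ _ _ _ hP c (omega / 4) eta_l L i (K_ n)
    (lt_le_trans ltr01 c1) omega4_c (ltW eta_l_gt0).
  rewrite Leta in h.
  by have [_ []] := h xc1 xc2 (smooth _ i (goodK n)) l (ltnW lL).
move=> N; split=> [i|n nN]; last exact/good_G0/goodK.
have rateE : L%:R * 1 * eta_l * mu P ^+ 2 * sR / spec i = x * a i.
  by rewrite mulr1 Leta /a !mulrA.
have boundE : 4 * het_bound P Kstar i e = omega ^+ 2 / a i.
  rewrite omega2 /a /het_bound -/ups -/(spec i) -/sR; field.
  by rewrite !gt_eqF.
rewrite rateE boundE -/K_; have [st _] := goodK N i.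
apply: (eq_le_eq (gapE _ _ st) (congr1 (fun z => _ * z + _)%E (gapE _ _ (K0_stab i)))).
rewrite -EFinM -EFinD lee_fin.
apply: (affine_recurrence (u := fun n => gap i (K_ n))).
- by rewrite subr_ge0.
- by rewrite divr_ge0 ?sqr_ge0 // ltW.
move=> n; have [_] := step n (goodK n) i; congr (is_true (_ <= _ + _)).
by move: (a i) (a_gt0 i) => ai ai_gt0; field; rewrite gt_eqF.
Qed.
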